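(* Let $\Phi$ be a Young function with complementary Young function $\Psi$, let $u:\Omega\to\mathbb{C}$ be $\Sigma$-measurable, and let $T=EM_u$, $T(f)=E(uf)$, be bounded on $L^{\Phi}(\Sigma)$. Then the following hold. (a) If $T$ is compact, then for every $\varepsilon>0$ the set $N_{\varepsilon}(E(u))=\{x\in\Omega:|E(u)(x)|\ge\varepsilon\}$ consists of finitely many $\mathcal{A}$-atoms. (b) If $T$ is compact and $\Phi\in\Delta'$ (globally), then for every $\varepsilon>0$ the set $$N_{\varepsilon}(\Psi^{-1}(E(\Psi(u))))=\{x\in\Omega:\Psi^{-1}(E(\Psi(u)))(x)\ge\varepsilon\}$$ consists of finitely many $\mathcal{A}$-atoms. (c) If $(E,\Phi)$ satisfies the generalized conditional-type Hölder inequality and, for every $\varepsilon>0$, $N_{\varepsilon}(\Psi^{-1}(E(\Psi(u))))$ consists of finitely many $\mathcal{A}$-atoms, then $T$ is compact.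
   Context: $(\Omega,\Sigma,\mu)$ is a measure space and $\mathcal{A}\subseteq\Sigma$ is a sub-$\sigma$-algebra with $(\Omega,\mathcal{A},\mu|_{\mathcal{A}})$ $\sigma$-finite; in particular it has the finite subset property (every $A\in\mathcal{A}$ with $\mu(A)>0$ contains some $B\in\mathcal{A}$ with $0<\mu(B)<\infty$). $E=E^{\mathcal{A}}$ is the conditional expectation with respect to $\mathcal{A}$: $E(f)$ is the a.e. unique $\mathcal{A}$-measurable function with $\int_A f\,d\mu=\int_A E(f)\,d\mu$ for all $A\in\mathcal{A}$, defined for nonnegative $f$ (with values in $[0,\infty]$) and extended to complex $f$ with $E(|f|)<\infty$ a.e. An $\mathcal{A}$-atom is a set $A\in\mathcal{A}$ with $\mu(A)>0$ such that every $F\in\mathcal{A}$ with $F\subseteq A$ has $\mu(F)=0$ or $\mu(F)=\mu(A)$. A set ''consists of finitely many $\mathcal{A}$-atoms'' if, up to a null set, it is a union of finitely many (possibly zero) disjoint $\mathcal{A}$-atoms. A Young function is a continuous convex $\Phi:\mathbb{R}\to[0,\infty)$ with $\Phi(x)=0$ iff $x=0$, $\Phi(-x)=\Phi(x)$, and $\lim_{x\to\infty}\Phi(x)/x=\infty$. Its complementary Young function is $\Psi(y)=\sup\{x|y|-\Phi(x):x\ge 0\}$. $\Phi^{-1},\Psi^{-1}$ are the inverses of the restrictions to $[0,\infty)$ (with value $\infty$ at $\infty$, and $0\cdot\infty=0$). For complex-valued $f$, $\Phi(f)$ means $\Phi(|f|)$, and likewise for $\Psi$. $\Phi\in\Delta'$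 (globally) means there is $c>0$ with $\Phi(xy)\le c\,\Phi(x)\Phi(y)$ for all $x,y\ge 0$. $L^{\Phi}(\Omega,\Sigma,\mu)=L^\Phi(\Sigma)$ is the Orlicz space of $\Sigma$-measurable $f:\Omega\to\mathbb{C}$ with $\int_\Omega\Phi(kf)\,d\mu<\infty$ for some $k>0$, with norm $N_\Phi(f)=\inf\{k>0:\int_\Omega\Phi(f/k)\,d\mu\le 1\}$. ''$T$ bounded on $L^\Phi(\Sigma)$'' means $E(uf)$ is defined for all $f\in L^\Phi(\Sigma)$ and $T$ maps $L^\Phi(\Sigma)$ boundedly into itself. $(E,\Phi)$ satisfies the generalized conditional-type Hölder inequality if there is a constant $C>0$ such that for all $f\in L^{\Phi}(\Omega,\Sigma,\mu)$ and $g\in L^{\Psi}(\Omega,\Sigma,\mu)$, almost everywhere, $$E(|fg|)\le C\,\Phi^{-1}(E(\Phi(|f|)))\,\Psi^{-1}(E(\Psi(|g|))).$$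
   Formalization: In (b) and (c) the complementary function Ψ is explicitly assumed to be itself a Young function; otherwise, e.g. for Φ(x)=|x|+x², Ψ vanishes on an interval [0,a], the inverse Ψ^{-1} does not exist, and (b) fails for generalized inverses. *)

(* Defs.v *)
From HB Require Import structures.
From mathcomp Require Import all_boot all_order all_algebra.
From mathcomp Require Export complex.
From mathcomp Require Import all_classical all_reals all_analysis.
                                                                      
From mathcomp Require Import measurable_realfun.

Set Implicit Arguments.
Unset Strict Implicit.
Unset Printing Implicit Defensive.

Import Order.TTheory GRing.Theory Num.Theory.
Import numFieldNormedType.Exports.

Local Open Scope classical_set_scope.
Local Open Scope complex_scope.
Local Open Scope ring_scope.

Section YoungFunctions.
Context {R : realType}.
Implicit Types Phi F : R -> R.

Definition young_function Phi : Prop :=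
  [/\ continuous Phi,
      convex_function (E := R^o) [set: R^o] Phi,
      (forall x, 0 <= Phi x),
      (forall x, Phi x = 0 <-> x = 0) &
      (forall x, Phi (- x) = Phi x) /\
      (Phi x / x @[x --> +oo] --> +oo)].

                                                                          
Definition complementary Phi (y : R) : R :=
  sup [set x * `|y| - Phi x | x in [set x | 0 <= x]].

                                                                           
                                                                              
                                                     
Definition young_inv F (t : \bar R) : \bar R :=
  match t with
  | r%:E => ('pinv_(fun=> 0) [set x | 0 <= x] F r)%:E
  | +oo%E => +oo%E
  | -oo%E => 0%E
  end.

Definition delta_prime Phi : Prop :=
  exists2 c : R, 0 < c &
    forall x y, 0 <= x -> 0 <= y -> Phi (x * y) <= c * Phi x * Phi y.

End YoungFunctions.

Section OrliczSpace.
Context {R : realType} d {T : measurableType d}.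
Variable mu : {measure set T -> \bar R}.
Implicit Types (Phi : R -> R) (f g h : T -> R[i]).

Definition modulus f (x : T) : R := Normc.normc (f x).

Definition measurable_complex f : Prop :=
  measurable_fun [set: T] (fun x => complex.Re (f x)) /\
  measurable_fun [set: T] (fun x => complex.Im (f x)).

Definition in_orlicz Phi f : Prop :=
  measurable_complex f /\
  exists2 k : R, 0 < k &
    (\int[mu]_x (Phi (k * modulus f x))%:E < +oo)%E.

Definition orlicz_norm Phi f : R :=
  inf [set k | 0 < k /\ (\int[mu]_x (Phi (modulus f x / k))%:E <= 1)%E].

Definition orlicz_bounded Phi (A : (T -> R[i]) -> T -> R[i]) : Prop :=
  (forall f, in_orlicz Phi f -> in_orlicz Phi (A f)) /\
  exists M : R, forall f, in_orlicz Phi f ->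
    orlicz_norm Phi (A f) <= M * orlicz_norm Phi f.

(* Functions are not quotiented by almost-everywhere equality: orlicz_norm is a
   seminorm on representatives. Compactness is sequential: the image of a
   bounded sequence has a subsequence converging in norm to a point of the
   space. *)
Definition orlicz_compact Phi (A : (T -> R[i]) -> T -> R[i]) : Prop :=
  forall f : nat -> T -> R[i],
    (forall n, in_orlicz Phi (f n)) ->
    (exists M : R, forall n, orlicz_norm Phi (f n) <= M) ->
  exists (s : nat -> nat) (h : T -> R[i]),
    [/\ {homo s : m n / (m < n)%N >-> (m < n)%N},
        in_orlicz Phi h &
        orlicz_norm Phi (A (f (s n)) \- h) @[n --> \oo] --> (0 : R)].

End OrliczSpace.

Section ConditionalExpectation.
Context {R : realType} d {T : measurableType d}.
Variables (mu : {measure set T -> \bar R}) (G : set (set T)).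
Implicit Types (Phi : R -> R) (f g u : T -> R[i]) (S : set T).

Definition is_condexp (f g : T -> \bar R) : Prop :=
  [/\ measurable_fun [set: g_sigma_algebraType G]
        (g : g_sigma_algebraType G -> \bar R),
      (forall x, 0 <= g x)%E &
      forall B, G B -> (\int[mu]_(x in B) f x = \int[mu]_(x in B) g x)%E].

                                                                            
Definition condexp (f : T -> \bar R) : T -> \bar R :=
  xget (cst 0%E) [set g | is_condexp f g].

Definition condexp_abs f : T -> \bar R :=
  condexp (fun x => (modulus f x)%:E).

Definition condexp_defined f : Prop :=
  {ae mu, forall x, (condexp_abs f x < +oo)%E}.

Definition condexpR (f : T -> R) (x : T) : R :=
  fine (condexp (EFin \o f^\+) x) - fine (condexp (EFin \o f^\-) x).

                                                                             
                                        
Definition condexpC f (x : T) : R[i] :=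
  condexpR (fun y => complex.Re (f y)) x +i*
  condexpR (fun y => complex.Im (f y)) x.

Definition condexp_young Phi f : T -> \bar R :=
  condexp (fun x => (Phi (modulus f x))%:E).

Definition condexp_mul u f : T -> R[i] := condexpC (u \* f).

Definition condexp_mul_bounded Phi u : Prop :=
  (forall f, in_orlicz mu Phi f -> condexp_defined (u \* f)) /\
  orlicz_bounded mu Phi (condexp_mul u).

Definition holder_conditional Phi : Prop :=
  let Psi := complementary Phi in
  exists2 C : R, 0 < C &
    forall f g, in_orlicz mu Phi f -> in_orlicz mu Psi g ->
      {ae mu, forall x,
        (condexp_abs (f \* g)%R x <=
           C%:E * (young_inv Phi (condexp_young Phi f x) *
                   young_inv Psi (condexp_young Psi g x)))%E}.

Definition atom S : Prop :=
  [/\ G S, (0 < mu S)%E &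
      forall F, G F -> F `<=` S -> mu F = 0%E \/ mu F = mu S].

Definition finitely_many_atoms S : Prop :=
  exists (n : nat) (F : 'I_n -> set T),
    [/\ (forall i, atom (F i)), trivIset [set: 'I_n] F &
        mu.-negligible (S `+` \bigcup_i F i)].

End ConditionalExpectation.

(* Main.v *)
Require Import Defs.
From HB Require Import structures.
From mathcomp Require Import all_boot all_order all_algebra.
From mathcomp Require Import all_classical all_reals all_analysis measurable_realfun.
From mathcomp Require Import ring lra.

Set Implicit Arguments.
Unset Strict Implicit.
Unset Printing Implicit Defensive.

Import Order.TTheory GRing.Theory Num.Theory.
Import numFieldNormedType.Exports.

Local Open Scope classical_set_scope.
Local Open Scope ring_scope.

(** Write T f = E(u f), w = Psi^-1(E(Psi(u))) and N_e = {w >= e}.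

    Necessity.  If a set of the sub-sigma-algebra G is not, up to a null set,
    a finite union of atoms, it can be split again and again and so contains
    infinitely many disjoint sets A_n in G of finite positive measure
    ([not_finitely_many_atoms]).  Suppose that each A_n carries a function f_n
    in the unit ball with u f_n = 0 outside A_n.  By locality of E, the T f_n
    have disjoint supports up to null sets, so if their norms stay away from 0
    no subsequence converges ([not_orlicz_compact]).  It remains to produce
    f_n, with a_n normalised by Phi(a_n) mu(A_n) = 1.
    - If |E(u)| >= e on every A_n, then f_n = a_n 1_{A_n} works, because
      T f_n = a_n E(u) on A_n.
    - If w >= e on every A_n, then Young's equality provides a function v with
      |u| v = Phi(v) + Psi(u), where u has to be truncated first.  One takes
      f_n = a_n s v 1_{A_n} times the phase of the conjugate of u, with a
      scalar s that keeps the modular below 1.  The global condition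
      Phi(x y) <= c Phi(x) Phi(y) is what separates the height a_n from the
      shape s v, and makes the lower bound of the mean of T f_n over A_n
      proportional to a_n, with a factor independent of n
      ([dual_extremal]).  A Jensen-type inequality then bounds the modular of
      T f_n from below ([modular_ge_of_mean]).

    Sufficiency.  The conditional Hoelder inequality, applied to the
    restrictions of u to sets of finite measure inside {w < e}, gives
    |T f| <= 2 C e Phi^-1(E(Phi(f))) there, so that T f is of size O(e) in
    norm on {w < e}, uniformly for f in a ball ([modular_below_level]).  On
    N_e, which is a finite union of atoms, T f is constant on each atom, and
    these constants are bounded on balls since T is bounded.  Over all
    e = 1/(k+1) there are countably many constants for each member of the
    sequence, so a subsequence makes all of them converge.  Then T f_n
    converges almost everywhere to some h, uniformly on every N_e, and
    Fatou's lemma carries the O(e) bound on {w < e} over to h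
    ([compact_of_finitely_many_atoms]). *)

(** * Restricting a measure to a sub-sigma-algebra *)

Section Restriction.
Context (R : realType) (d : measure_display) (T : measurableType d).
Variables (mu : {measure set T -> \bar R}) (G : set (set T)).
Hypothesis hG : sigma_algebra [set: T] G.
Hypothesis hGsub : G `<=` (measurable : set (set T)).
Local Notation GT := (g_sigma_algebraType G).
Local Open Scope ereal_scope.

Lemma measurable_subP (B : set T) : G B <-> measurable (B : set GT).
Proof. by rewrite (measurable_g_measurableTypeE hG). Qed.

Lemma measurable_sub (B : set GT) : measurable B -> measurable (B : set T).
Proof. by move=> /measurable_subP /hGsub. Qed.

Lemma measurable_fun_sub d' (U : measurableType d') (g : GT -> U) :
  measurable_fun [set: GT] g -> measurable_fun [set: T] (g : T -> U).
Proof. by move=> mg _ Y mY; apply: measurable_sub; exact: mg. Qed.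

(** The measure itself, retyped as a set function on the measurable space that
    carries [G], so that it can receive a measure structure of its own there. *)
Definition sub_measure (B : set GT) : \bar R := mu B.

Let sub_measure0 : sub_measure set0 = 0. Proof. exact: measure0. Qed.
Let sub_measure_ge0 B : 0 <= sub_measure B. Proof. exact: measure_ge0. Qed.
Let sub_measure_additive : semi_sigma_additive sub_measure.
Proof.
move=> F mF tF mUF; apply: measure_semi_sigma_additive => //.
- by move=> i; exact: measurable_sub.
- exact: measurable_sub.
Qed.

HB.instance Definition _ := isMeasure.Build _ _ _ sub_measure
  sub_measure0 sub_measure_ge0 sub_measure_additive.

Definition sub_measure_measure : {measure set GT -> \bar R} := sub_measure.

Lemma integral_sub_measure (B : set T) (g : T -> \bar R) :
  measurable_fun [set: GT] (g : GT -> \bar R) -> (forall x, 0 <= g x) -> G B ->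
  \int[sub_measure]_(x in B) g x = \int[mu]_(x in B) g x.
Proof.
move=> mg g0 GB.
have mid : measurable_fun [set: T] (id : T -> GT).
  by move=> _ Y mY; rewrite setTI; exact: measurable_sub.
rewrite -[RHS](ge0_integral_pushforward mid mu)//.
- exact/measurable_subP.
- exact: measurable_funTS.
Qed.

Section Density.
Variable f : T -> \bar R.
Hypotheses (mf : measurable_fun [set: T] f) (f0 : forall x, 0 <= f x).
Hypothesis intf : \int[mu]_x f x < +oo.

Definition sub_density (B : set GT) : \bar R := \int[mu]_(x in B) f x.

Let sub_density0 : sub_density set0 = 0. Proof. exact: integral_set0. Qed.
Let sub_density_ge0 B : 0 <= sub_density B.
Proof. by apply: integral_ge0 => x _. Qed.
Let sub_density_additive : semi_sigma_additive sub_density.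
Proof.
move=> F mF tF mUF; apply: semi_sigma_additive_nng_induced => //.
- by move=> i; exact: measurable_sub.
- exact: measurable_sub.
Qed.

HB.instance Definition _ := isMeasure.Build _ _ _ sub_density
  sub_density0 sub_density_ge0 sub_density_additive.

Let sub_density_fin : fin_num_fun sub_density.
Proof.
move=> B mB; rewrite ge0_fin_numE ?sub_density_ge0//.
apply: le_lt_trans intf; apply: ge0_subset_integral => //.
exact: measurable_sub.
Qed.

HB.instance Definition _ :=
  Measure_isFinite.Build _ _ _ sub_density sub_density_fin.

Definition sub_density_finite_measure : {finite_measure set GT -> \bar R} :=
  sub_density.

Lemma sub_density_dominated : sub_density `<< sub_measure.
Proof.
apply/null_content_dominatesP => B mB; rewrite /sub_measure /= => muB0.
have mB' := measurable_sub mB.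
apply/eqP; rewrite eq_le sub_density_ge0 andbT /sub_density.
rewrite (@ge0_negligible_integral _ _ _ mu B B)// ?setDv ?integral_set0//.
exact: measurable_funTS.
Qed.

End Density.

End Restriction.

(** * Existence of conditional expectations *)

Section ConditionalExpectation.
Context (R : realType) (d : measure_display) (T : measurableType d).
Variables (mu : {measure set T -> \bar R}) (G : set (set T)).
Hypothesis hG : sigma_algebra [set: T] G.
Hypothesis hGsub : G `<=` (measurable : set (set T)).
Hypothesis hGfin : sigma_finite [set: g_sigma_algebraType G] mu.
Local Notation GT := (g_sigma_algebraType G).
Local Open Scope ereal_scope.

(** The Radon-Nikodym derivative on [G] of the finite measure with density
    [f]. *)
Lemma condexp_exists_integrable (f : T -> \bar R) :
  measurable_fun [set: T] f -> (forall x, 0 <= f x) -> \int[mu]_x f x < +oo ->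
  exists g, is_condexp mu G f g.
Proof.
move=> mf f0 intf.
pose m0 := sub_measure_measure mu hG hGsub.
pose H1 := Measure_isSigmaFinite.Build _ GT R m0 hGfin.
pose m : {sigma_finite_measure set GT -> \bar R} :=
  HB.pack (Measure.sort m0) m0 H1.
pose nu := sub_density_finite_measure hG hGsub mf f0 intf.
have [//|g [g0 _ intg nuE]] := @radon_nikodym_sigma_finite _ GT R m nu.
  exact: sub_density_dominated.
have mg : measurable_fun [set: GT] g := measurable_int m intg.
exists g; split => // B GB.
rewrite -[RHS](integral_sub_measure mu hG hGsub)//.
by apply: nuE; exact/(measurable_subP hG).
Qed.

Lemma sub_setI (A B : set T) : G A -> G B -> G (A `&` B).
Proof.
move=> /(measurable_subP hG) GA /(measurable_subP hG) GB.
by apply/(measurable_subP hG); exact: measurableI.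
Qed.

Lemma sub_setD (A B : set T) : G A -> G B -> G (A `\` B).
Proof.
move=> /(measurable_subP hG) GA /(measurable_subP hG) GB.
by apply/(measurable_subP hG); exact: measurableD.
Qed.

Lemma sub_setT : G [set: T].
Proof. exact/(measurable_subP hG). Qed.

Lemma sub_exhaustion : exists2 F : nat -> set T,
  \bigcup_n F n = [set: T] & forall n, G (F n) /\ mu (F n) < +oo.
Proof.
have [F FT mF] := hGfin; exists F => // n.
by have [/(measurable_subP hG)] := mF n.
Qed.

(** The measure with density [f] need not be sigma-finite on [G], so the
    Radon-Nikodym theorem does not apply to it directly.  Instead [f] is cut
    along a countable partition into sets, measurable for the large
    sigma-algebra only, on which it is integrable, and the conditional
    expectations of the pieces are added up. *)
Lemma condexp_exists (f : T -> R) : measurable_fun [set: T] f ->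
  (forall x, (0 <= f x)%R) -> exists g, is_condexp mu G (EFin \o f) g.
Proof.
move=> mf f0; have [F FT GF] := sub_exhaustion.
(* pairs (j, n) are coded by a single index p, ready to be made disjoint *)
pose H (p : nat) := let: (j, n) := odflt (0, 0)%N (unpickle p) in
  F j `&` [set x | (f x <= n%:R)%R].
have mH p : measurable (H p).
  rewrite /H; case: (odflt _ _) => j n; apply: measurableI.
    by apply: hGsub; exact: (GF j).1.
  rewrite [X in measurable X](_ : _ = setT `&` f @^-1` `]-oo, n%:R]).
    exact: mf.
  by rewrite setTI; apply/seteqP; split => x /=; rewrite in_itv.
have HT : \bigcup_p H p = [set: T].
  apply/seteqP; split => // x _.
  have : (\bigcup_n F n) x by rewrite FT.
  move=> [j _ Fjx]; exists (pickle (j, (Num.truncn (f x)).+1)%N) => //.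
  rewrite /H pickleK /=; split => //=.
  exact/ltW/truncnS_gt.
have mE p : measurable (seqDU H p).
  by apply: measurableD => //; exact: bigsetU_measurable.
pose fE p := (EFin \o f) \_ (seqDU H p).
have mfE p : measurable_fun [set: T] (fE p).
  apply/(measurable_restrictT _ _).1 => //.
  exact/measurable_funTS/measurable_EFinP.
have fE0 p x : 0 <= fE p x by apply: erestrict_ge0 => y _ /=; rewrite lee_fin.
have intfE p : \int[mu]_x fE p x < +oo.
  rewrite /fE -integral_mkcond.
  apply: (@le_lt_trans _ _ (\int[mu]_(x in H p) (f x)%:E)).
    apply: ge0_subset_integral => //.
    - exact/measurable_funTS/measurable_EFinP.
    - by move=> x _; rewrite lee_fin.
    - exact: subDsetl.
  have := mH p; rewrite /H; case: (odflt _ _) => j n mHjn.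
  apply: (@le_lt_trans _ _
    (\int[mu]_(x in F j `&` [set x | (f x <= n%:R)%R]) n%:R%:E)).
    apply: ge0_le_integral => //.
    - by move=> x _; rewrite lee_fin.
    - exact/measurable_funTS/measurable_EFinP.
    - by move=> x [_ /=]; rewrite lee_fin.
  rewrite integral_cst//; apply: lte_mul_pinfty => //.
  apply: le_lt_trans (GF j).2; apply: le_measure; rewrite ?inE//.
  exact: hGsub (GF j).1.
have [g gP] :=
  choice (fun p => condexp_exists_integrable (mfE p) (fE0 p) (intfE p)).
exists (fun x => \sum_(0 <= p <oo) g p x); split.
- apply: ge0_emeasurable_sum => [p x _ _|p _]; by case: (gP p).
- by move=> x; apply: nneseries_ge0 => p _ _; case: (gP p).
move=> B GB; have mB := hGsub GB.
rewrite integral_nneseries//; last 2 first.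
- move=> p; apply: measurable_funTS; apply: (measurable_fun_sub hG hGsub).
  by case: (gP p).
- by move=> p x _; case: (gP p).
rewrite -[X in \int[mu]_(x in X) _](setIT B) -HT seqDU_bigcup_eq setI_bigcupr.
rewrite ge0_integral_bigcup//; last 4 first.
- by move=> p; exact: measurableI.
- exact/measurable_funTS/measurable_EFinP.
- by move=> x _; rewrite lee_fin.
- exact/trivIset_setIl/trivIset_seqDU.
apply: eq_eseriesr => p _; case: (gP p) => _ _ <- //.
by rewrite integral_mkcondr.
Qed.
End ConditionalExpectation.

(** * Conditional expectations up to null sets *)

Section Comparison.
Context (R : realType) (d : measure_display) (T : measurableType d).
Variables (mu : {measure set T -> \bar R}) (G : set (set T)).
Hypothesis hG : sigma_algebra [set: T] G.
Hypothesis hGsub : G `<=` (measurable : set (set T)).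
Hypothesis hGfin : sigma_finite [set: g_sigma_algebraType G] mu.
Local Notation GT := (g_sigma_algebraType G).
Local Open Scope ereal_scope.

(** The set where [g2 < g1] is covered by countably many sets of [G] of finite
    measure on which [g2] is bounded and [g1] exceeds it by a fixed constant;
    comparing the integrals over such a set shows that it is null. *)
Lemma sub_fun_le_on (A : set T) (g1 g2 : T -> \bar R) : G A ->
  measurable_fun [set: GT] (g1 : GT -> \bar R) ->
  measurable_fun [set: GT] (g2 : GT -> \bar R) ->
  (forall x, 0 <= g1 x) -> (forall x, 0 <= g2 x) ->
  (forall B, G B -> B `<=` A ->
    \int[mu]_(x in B) g1 x <= \int[mu]_(x in B) g2 x) ->
  {ae mu, forall x, A x -> g1 x <= g2 x}.
Proof.
move=> GA mg1 mg2 g10 g20 le12; have [F FT GF] := sub_exhaustion hG hGfin.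
pose c m : R := (m.+1%:R^-1)%R.
pose B j n m := (A `&` F j) `&` ([set x | g2 x <= n%:R%:E] `&`
   [set x | g2 x + (c m)%:E <= g1 x]).
have GB j n m : G (B j n m).
  apply: (sub_setI hG); first exact: sub_setI hG _ _ GA (GF j).1.
  apply: (sub_setI hG); apply/(measurable_subP hG).
    by rewrite -[X in measurable X]setTI; exact: emeasurable_fun_infty_c.
  rewrite -[X in measurable X]setTI; apply: measurable_lee => //.
  exact: emeasurable_funD.
have B0 j n m : mu (B j n m) = 0.
  have GBB := GB j n m; have mB := hGsub GBB.
  have BA : B j n m `<=` A by move=> x [[]].
  have finB : mu (B j n m) < +oo.
    apply: le_lt_trans (GF j).2; apply: le_measure; rewrite ?inE//.
      exact: hGsub (GF j).1.
    by move=> x [[]].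
  have mg1' := measurable_fun_sub hG hGsub mg1.
  have mg2' := measurable_fun_sub hG hGsub mg2.
  have fin2 : \int[mu]_(x in B j n m) g2 x < +oo.
    apply: (@le_lt_trans _ _ (\int[mu]_(x in B j n m) n%:R%:E)).
      apply: ge0_le_integral => //.
        exact: measurable_funTS.
      by move=> x [_ []].
    by rewrite integral_cst//; exact: lte_mul_pinfty.
  have := le12 _ GBB BA.
  have : \int[mu]_(x in B j n m) (g2 x + (c m)%:E) <=
         \int[mu]_(x in B j n m) g1 x.
    apply: ge0_le_integral => //.
    - by move=> x _; rewrite adde_ge0// lee_fin invr_ge0.
    - by apply: measurable_funTS; exact: emeasurable_funD.
    - exact: measurable_funTS.
    - by move=> x [_ []].
  move=> /le_trans /[apply].
  rewrite ge0_integralD//; last 2 first.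
  - exact: measurable_funTS.
  - by move=> x _; rewrite lee_fin invr_ge0.
  rewrite integral_cst// -lee_suber_addl; last first.
    by rewrite ge0_fin_numE// integral_ge0.
  rewrite subee; last by rewrite ge0_fin_numE// integral_ge0.
  rewrite pmule_rle0 ?lte_fin ?invr_gt0// => muB.
  by apply/eqP; rewrite eq_le muB measure_ge0.
apply: (@negligibleS _ _ _ _
  (\bigcup_j \bigcup_n \bigcup_m B j n m)); last first.
  do 3! (apply: negligible_bigcup => ?).
  by apply/negligibleP; [exact: hGsub|exact: B0].
move=> x /= /not_implyP[Ax /negP]; rewrite -ltNge => lt21.
have [j _ Fjx] : (\bigcup_n F n) x by rewrite FT.
have g2fin : g2 x \is a fin_num.
  by rewrite ge0_fin_numE//; exact: lt_le_trans lt21 (leey _).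
exists j => //; exists (Num.truncn (fine (g2 x))).+1 => //.
have [m hm] : exists m, g2 x + (c m)%:E <= g1 x.
  move: lt21 (g10 x); rewrite -(fineK g2fin); case: (g1 x) => [s||]//.
    rewrite lte_fin => rs _; exists (Num.truncn (s - fine (g2 x))^-1%R).
    rewrite -EFinD lee_fin -lerBrDl /c invf_ple ?posrE ?subr_gt0//.
    exact/ltW/truncnS_gt.
  by move=> _ _; exists 0%N; exact: leey.
exists m => //; split; first by split.
split => //=; rewrite -(fineK g2fin) lee_fin; exact/ltW/truncnS_gt.
Qed.

Lemma condexpP (f : T -> R) : measurable_fun [set: T] f ->
  (forall x, (0 <= f x)%R) ->
  is_condexp mu G (EFin \o f) (condexp mu G (EFin \o f)).
Proof.
move=> mf f0; rewrite /condexp; case: xgetP => // none.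
by have [g /none] := condexp_exists hG hGsub hGfin mf f0.
Qed.

Lemma condexp_ge0 (f : T -> \bar R) x : 0 <= condexp mu G f x.
Proof. by rewrite /condexp; case: xgetP => [g _ []|]. Qed.

Lemma condexp_le_on (A : set T) (f g : T -> R) : G A ->
  measurable_fun [set: T] f -> measurable_fun [set: T] g ->
  (forall x, (0 <= f x)%R) -> (forall x, (0 <= g x)%R) ->
  (forall x, A x -> (f x <= g x)%R) ->
  {ae mu, forall x, A x ->
    condexp mu G (EFin \o f) x <= condexp mu G (EFin \o g) x}.
Proof.
move=> GA mf mg f0 g0 fg.
have [mcf _ cfE] := condexpP mf f0; have [mcg _ cgE] := condexpP mg g0.
apply: (sub_fun_le_on GA mcf mcg (condexp_ge0 _) (condexp_ge0 _)) => B GB BA.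
rewrite -cfE// -cgE//; apply: ge0_le_integral => //.
- exact: hGsub.
- by move=> x _ /=; rewrite lee_fin.
- exact/measurable_funTS/measurable_EFinP.
- exact/measurable_funTS/measurable_EFinP.
- by move=> x Bx; rewrite lee_fin; exact/fg/BA.
Qed.

Lemma sub_fun_eq_on (A : set T) (g1 g2 : T -> \bar R) : G A ->
  measurable_fun [set: GT] (g1 : GT -> \bar R) ->
  measurable_fun [set: GT] (g2 : GT -> \bar R) ->
  (forall x, 0 <= g1 x) -> (forall x, 0 <= g2 x) ->
  (forall B, G B -> B `<=` A ->
    \int[mu]_(x in B) g1 x = \int[mu]_(x in B) g2 x) ->
  {ae mu, forall x, A x -> g1 x = g2 x}.
Proof.
move=> GA mg1 mg2 g10 g20 E12.
have le12 : {ae mu, forall x, A x -> g1 x <= g2 x}.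
  by apply: sub_fun_le_on => // B GB BA; rewrite E12.
have le21 : {ae mu, forall x, A x -> g2 x <= g1 x}.
  by apply: sub_fun_le_on => // B GB BA; rewrite E12.
apply: filterS2 le12 le21 => x l12 l21 Ax.
by apply/eqP; rewrite eq_le l12// l21.
Qed.

(** Locality: integrals over sets of [G] inside [A] only see values on [A].
    The case [a = 0] says that vanishing on [A] is inherited. *)
Lemma condexp_scale_on (A : set T) (a : R) (f g : T -> R) : G A ->
  measurable_fun [set: T] f -> measurable_fun [set: T] g ->
  (forall x, (0 <= f x)%R) -> (forall x, (0 <= g x)%R) -> (0 <= a)%R ->
  (forall x, A x -> g x = (a * f x)%R) ->
  {ae mu, forall x, A x ->
    condexp mu G (EFin \o g) x = a%:E * condexp mu G (EFin \o f) x}.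
Proof.
move=> GA mf mg f0 g0 a0 gf.
have [mcf _ cfE] := condexpP mf f0; have [mcg _ cgE] := condexpP mg g0.
apply: sub_fun_eq_on => // [|x|x|B GB BA].
- exact: measurable_funeM.
- exact: condexp_ge0.
- by rewrite mule_ge0// ?lee_fin// condexp_ge0.
have mB := hGsub GB.
rewrite -cgE// ge0_integralZl//; last 2 first.
- exact/measurable_funTS/(measurable_fun_sub hG hGsub mcf).
- by move=> x _; exact: condexp_ge0.
rewrite -cfE// -ge0_integralZl//; last 2 first.
- exact/measurable_funTS/measurable_EFinP.
- by move=> x _; rewrite /= lee_fin.
by apply: eq_integral => x /[!inE] Bx /=; rewrite gf ?EFinM//; exact: BA.
Qed.

Lemma condexp_eq_on (A : set T) (f g : T -> R) : G A ->
  measurable_fun [set: T] f -> measurable_fun [set: T] g ->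
  (forall x, (0 <= f x)%R) -> (forall x, (0 <= g x)%R) ->
  (forall x, A x -> g x = f x) ->
  {ae mu, forall x, A x ->
    condexp mu G (EFin \o g) x = condexp mu G (EFin \o f) x}.
Proof.
move=> GA mf mg f0 g0 gf.
have := @condexp_scale_on A 1%R f g GA mf mg f0 g0 ler01.
move=> /(_ (fun x Ax => etrans (gf x Ax) (esym (mul1r _)))).
by apply: filterS => x E Ax; rewrite E// mul1e.
Qed.

(** Up to null sets an atom has no measurable subsets other than the empty set
    and itself, so the mean of [f] over it has the defining property of the
    conditional expectation there. *)
Lemma condexp_atom (A : set T) (f : T -> R) : atom mu G A ->
  mu A < +oo -> measurable_fun [set: T] f -> (forall x, (0 <= f x)%R) ->
  exists c, {ae mu, forall x, A x -> condexp mu G (EFin \o f) x = c}.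
Proof.
move=> [GA A0 Aatom] Afin mf f0.
have [mcf _ cfE] := condexpP mf f0.
have mA := hGsub GA.
have muAfin : mu A \is a fin_num by rewrite ge0_fin_numE.
pose I := \int[mu]_(x in A) (f x)%:E.
have I0 : 0 <= I by apply: integral_ge0 => x _; rewrite lee_fin.
have fA0 : (0 < fine (mu A))%R by rewrite fine_gt0// A0.
exists (I * ((fine (mu A))^-1)%:E).
apply: sub_fun_eq_on => // [x|x|B GB BA].
- exact: condexp_ge0.
- by rewrite mule_ge0// lee_fin invr_ge0 ltW.
have mB := hGsub GB.
rewrite -cfE// integral_cst//.
have [B0|BA'] := Aatom _ GB BA.
  rewrite B0 mule0 (@ge0_negligible_integral _ _ _ mu B B)// ?setDv ?integral_set0//.
    exact/measurable_funTS/measurable_EFinP.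
  by move=> x _; rewrite /= lee_fin.
rewrite BA' -muleA -[X in _ * X]/(_ * mu A) -[in X in _ * X](fineK muAfin) -EFinM.
rewrite mulVf ?gt_eqF// mule1 /I.
have muAB : mu (A `\` B) = 0.
  rewrite measureD//; have /setIidPr -> := BA.
  by rewrite [X in _ - X](_ : _ = mu A) ?subee//; exact: BA'.
rewrite [RHS](@ge0_negligible_integral _ _ _ mu A (A `\` B))//.
- by rewrite setDD; have /setIidPr -> := BA.
- exact: measurableD.
- exact/measurable_funTS/measurable_EFinP.
- by move=> x _; rewrite lee_fin.
Qed.

End Comparison.

(** * Sets that are not finite unions of atoms *)

Section Atoms.
Context (R : realType) (d : measure_display) (T : measurableType d).
Variables (mu : {measure set T -> \bar R}) (G : set (set T)).
Hypothesis hG : sigma_algebra [set: T] G.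
Hypothesis hGsub : G `<=` (measurable : set (set T)).
Hypothesis hGfin : sigma_finite [set: g_sigma_algebraType G] mu.
Local Notation GT := (g_sigma_algebraType G).
Local Open Scope ereal_scope.

(** A variant of [finitely_many_atoms] in which the atoms lie inside [S]
    exactly, so that atoms of disjoint sets are disjoint and the property
    passes to disjoint unions. *)
Definition atomic_inside (S : set T) := exists (n : nat) (F : 'I_n -> set T),
  [/\ forall i, atom mu G (F i), forall i, F i `<=` S,
      trivIset [set: 'I_n] F & mu.-negligible (S `\` \bigcup_i F i)].

Lemma atomic_inside_finitely S : atomic_inside S -> finitely_many_atoms mu G S.
Proof.
move=> [n [F [aF FS tF nF]]]; exists n, F; split => //.
apply: negligibleS nF => x [//|[[i _ Fix] nSx]].
by case: nSx; exact: FS Fix.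
Qed.

Lemma atomic_inside_null S : mu.-negligible S -> atomic_inside S.
Proof.
move=> S0; exists 0%N, (fun=> set0); split => //; try by case.
by apply: negligibleS S0 => x [].
Qed.

Lemma atomic_inside_atom S : atom mu G S -> atomic_inside S.
Proof.
move=> aS; exists 1%N, (fun=> S); split => //; first by move=> _.
  by move=> i j _ _ _; rewrite (ord1 i) (ord1 j).
apply: negligibleS (negligible_set0 mu) => x [Sx nU].
by case: nU; exists ord0.
Qed.

Lemma atomic_insideU S1 S2 : S1 `&` S2 = set0 ->
  atomic_inside S1 -> atomic_inside S2 -> atomic_inside (S1 `|` S2).
Proof.
move=> S120 [n1 [F1 [a1 s1 t1 N1]]] [n2 [F2 [a2 s2 t2 N2]]].
pose F (i : 'I_(n1 + n2)) :=
  match fintype.split i with inl j => F1 j | inr k => F2 k end.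
have EL j : F (lshift n2 j) = F1 j by rewrite /F (unsplitK (inl j)).
have ER k : F (rshift n1 k) = F2 k by rewrite /F (unsplitK (inr k)).
have disj j k x : F1 j x -> F2 k x -> False.
  by move=> /s1 S1x /s2 S2x; rewrite -[False]/(set0 x) -S120.
exists (n1 + n2)%N, F; split.
- by move=> i; case: (split_ordP i) => j ->; rewrite ?EL ?ER.
- move=> i x; case: (split_ordP i) => j ->; rewrite ?EL ?ER => Fx.
    by left; exact: s1 Fx.
  by right; exact: s2 Fx.
- move=> i j _ _ [x []].
  case: (split_ordP i) => i' ->; case: (split_ordP j) => j' ->;
    rewrite ?EL ?ER => Fi Fj.
  + by rewrite (t1 i' j')//; exists x.
  + by case: (disj _ _ _ Fi Fj).
  + by case: (disj _ _ _ Fj Fi).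
  + by rewrite (t2 i' j')//; exists x.
- apply: negligibleS (negligibleU N1 N2) => x [[Sx|Sx] nF]; [left|right];
    split => // -[i _ Fi]; apply: nF.
  + by exists (lshift n2 i) => //; rewrite EL.
  + by exists (rshift n1 i) => //; rewrite ER.
Qed.

(** [S] is neither null nor an atom, hence splits into two parts of positive
    measure; since finite unions of atoms add up, one of the parts fails to be
    one and can be kept. *)
Lemma not_atomic_inside_split S : G S -> ~ atomic_inside S ->
  exists S', [/\ G S', ~ atomic_inside S', S' `<=` S & 0 < mu (S `\` S')].
Proof.
move=> GS nS.
have muS : mu S != 0.
  apply/eqP => S0; apply: nS; apply: atomic_inside_null.
  exact/negligibleP/S0/hGsub.
have [F [GF FS F0 FneS]] :
    exists F, [/\ G F, F `<=` S, mu F <> 0 & mu F <> mu S].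
  apply: contrapT => noF; apply: nS; apply: atomic_inside_atom; split => //.
    by rewrite lt0e muS measure_ge0.
  move=> F GF FS; apply: contrapT => /not_orP[F0 FS'].
  by apply: noF; exists F.
have GD := sub_setD hG GS GF.
have mF := hGsub GF; have mD := hGsub GD.
have SE : F `|` (S `\` F) = S by exact: setDUK.
have [aF|nF] := pselect (atomic_inside F).
  exists (S `\` F); split => //.
  - move=> aD; apply: nS; rewrite -SE; apply: atomic_insideU => //.
    by rewrite setDIK.
  - rewrite setDD; have /setIidPr -> := FS.
    by rewrite lt0e measure_ge0 andbT; exact/eqP.
exists F; split => //; rewrite lt0e measure_ge0 andbT; apply/eqP => D0.
apply: FneS; have -> : mu S = mu F + mu (S `\` F).
  by rewrite -measureU ?setDIK// SE.
by rewrite D0 adde0.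
Qed.

(** Iterating the splitting gives a decreasing sequence of sets, and the
    successive differences are disjoint and of positive measure; sigma-finiteness
    of the restricted measure cuts them down to finite measure. *)
Lemma not_finitely_many_atoms S : G S -> ~ finitely_many_atoms mu G S ->
  exists A : nat -> set T, [/\ forall n, G (A n), forall n, A n `<=` S,
    forall n, 0 < mu (A n) < +oo & trivIset [set: nat] A].
Proof.
move=> GS nS.
pose X := {B : set T | G B /\ ~ atomic_inside B}.
have S0 : G S /\ ~ atomic_inside S.
  by split => // /atomic_inside_finitely.
pose r (B B' : X) := sval B' `<=` sval B /\ 0 < mu (sval B `\` sval B').
have /dependent_choice : forall B : X, {B' : X | r B B'}.
  move=> [B [GB nB]]; apply: cid.
  have [B' [GB' nB' sB pB]] := not_atomic_inside_split GB nB.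
  by exists (exist _ B' (conj GB' nB')).
move=> /(_ (exist _ S S0)) [s [s0 rs]].
pose B n := sval (s n) `\` sval (s n.+1).
have GB n : G (B n) by apply: (sub_setD hG); exact: (svalP (s _)).1.
have decr m n : (m <= n)%N -> sval (s n) `<=` sval (s m).
  move=> /subnK <-; elim: (n - m)%N => //= k IH.
  by apply: subset_trans IH; exact: (rs _).1.
have [F FT GF] := sub_exhaustion hG hGfin.
have exj n : exists j, 0 < mu (B n `&` F j).
  apply: contrapT => /forallNP h.
  have : mu (B n) = 0.
    apply/negligibleP; first exact: hGsub.
    rewrite -[B n](setIT) -FT setI_bigcupr; apply: negligible_bigcup => j.
    apply/negligibleP; first by apply/hGsub/(sub_setI hG) => //; exact: (GF j).1.
    by apply/eqP/negP => /negP h0; apply: (h j); rewrite lt0e h0 measure_ge0.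
  by apply/eqP; rewrite gt_eqF//; exact: (rs n).2.
have [j hj] := choice exj.
exists (fun n => B n `&` F (j n)); split => [n|n|n|].
- by apply: (sub_setI hG) => //; exact: (GF _).1.
- move=> x [[sx _] _]; have := decr 0%N n (leq0n _) _ sx.
  by rewrite s0.
- rewrite hj /=; apply: le_lt_trans (GF (j n)).2.
  apply: le_measure; rewrite ?inE//.
  + by apply/hGsub/(sub_setI hG) => //; exact: (GF _).1.
  + exact: hGsub (GF _).1.
- have key m n x : (m < n)%N -> B m x -> B n x -> False.
    by move=> mn [_ nx] [sx _]; apply: nx; exact: (decr m.+1 n mn).
  move=> m n _ _ [x [[Bm _] [Bn _]]].
  case: (ltngtP m n) => // mn.
    by case: (key _ _ _ mn Bm Bn).
  by case: (key _ _ _ mn Bn Bm).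
Qed.

Lemma atom_lty (A : set T) : atom mu G A -> mu A < +oo.
Proof.
move=> [GA A0 Aatom]; have [F FT GF] := sub_exhaustion hG hGfin.
apply: contrapT => Afin.
have : mu A = 0.
  apply/negligibleP; first exact: hGsub.
  rewrite -[A](setIT) -FT setI_bigcupr; apply: negligible_bigcup => j.
  have GAF : G (A `&` F j) by apply: (sub_setI hG) => //; exact: (GF j).1.
  apply/negligibleP; first exact: hGsub.
  have [//|AFA] := Aatom _ GAF (@subIsetl _ _ _).
  case: Afin; rewrite -AFA; apply: le_lt_trans (GF j).2.
  apply: le_measure; rewrite ?inE//; [exact: hGsub|exact: hGsub (GF _).1].
by move=> A00; rewrite A00 ltxx in A0.
Qed.

End Atoms.

(** * Young functions *)

Section YoungFacts.
Context {R : realType}.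
Variable Phi : R -> R.
Hypothesis hPhi : young_function Phi.

Lemma young0 : Phi 0 = 0.
Proof. by case: hPhi => _ _ _ h _; apply/h. Qed.

Lemma young_ge0 x : 0 <= Phi x.
Proof. by case: hPhi. Qed.

Lemma young_gt0 x : 0 < x -> 0 < Phi x.
Proof.
move=> x0; rewrite lt_neqAle young_ge0 andbT; apply/eqP => /esym.
by case: hPhi => _ _ _ h _ /h x00; rewrite x00 ltxx in x0.
Qed.

Lemma young_convex t x y : 0 <= t -> t <= 1 ->
  Phi (t * x + (1 - t) * y) <= t * Phi x + (1 - t) * Phi y.
Proof.
move=> t0 t1; case: hPhi => _ cvx _ _ _.
exact: (cvx (Itv01 t0 t1) x y (mem_setT _) (mem_setT _)).
Qed.

Lemma young_scale_le t x : 0 <= t -> t <= 1 -> Phi (t * x) <= t * Phi x.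
Proof.
move=> t0 t1; have := @young_convex t x 0 t0 t1.
by rewrite young0 !mulr0 !addr0.
Qed.

Lemma young_scale_ge t x : 1 <= t -> t * Phi x <= Phi (t * x).
Proof.
move=> t1; have t0 : 0 < t := lt_le_trans ltr01 t1.
have := @young_scale_le t^-1 (t * x); rewrite mulKf ?gt_eqF//.
rewrite invr_ge0 invf_le1// (ltW t0) => /(_ erefl t1).
by rewrite ler_pdivlMl.
Qed.

Lemma young_le x y : 0 <= x -> x <= y -> Phi x <= Phi y.
Proof.
move=> x0; rewrite le_eqVlt => /predU1P[->//|xy].
have y0 : 0 < y := le_lt_trans x0 xy.
have := @young_scale_le (x / y) y; rewrite divfK ?gt_eqF//.
rewrite divr_ge0 ?(ltW y0)// ler_pdivrMr// mul1r (ltW xy) => /(_ erefl erefl).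
move=> /le_trans; apply; rewrite ler_piMl ?young_ge0//.
by rewrite ler_pdivrMr// mul1r ltW.
Qed.

Lemma young_lt x y : 0 <= x -> x < y -> Phi x < Phi y.
Proof.
move=> x0 xy; have y0 : 0 < y := le_lt_trans x0 xy.
have := @young_scale_le (x / y) y; rewrite divfK ?gt_eqF//.
rewrite divr_ge0 ?(ltW y0)// ler_pdivrMr// mul1r (ltW xy) => /(_ erefl erefl).
move=> /le_lt_trans; apply; rewrite gtr_pMl ?young_gt0//.
by rewrite ltr_pdivrMr// mul1r.
Qed.

Lemma young_half x y : Phi ((x + y) / 2) <= (Phi x + Phi y) / 2.
Proof.
have := @young_convex 2^-1 x y; rewrite invr_ge0 ler0n invf_le1// ler1n.
move=> /(_ erefl erefl).
by rewrite (_ : 1 - 2^-1 = 2^-1); [rewrite -!mulrDr ![2^-1 * _]mulrC|field].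
Qed.

Lemma young_continuous : continuous Phi.
Proof. by case: hPhi. Qed.

Lemma young_measurable : measurable_fun [set: R] Phi.
Proof. apply: continuous_measurable_fun; exact: young_continuous. Qed.

(** Convexity gives [Phi X >= X * Phi 1] for [X >= 1], so the intermediate
    value theorem applies on a large enough interval. *)
Lemma young_surjective r : 0 <= r -> exists2 x, 0 <= x & Phi x = r.
Proof.
move=> r0; pose X := Num.max 1 (r / Phi 1).
have P1 : 0 < Phi 1 by exact: young_gt0.
have X1 : 1 <= X by rewrite le_max lexx.
have PX : r <= Phi X.
  have := @young_scale_ge X 1 X1; rewrite mulr1; apply: le_trans.
  by rewrite -ler_pdivrMr// le_max lexx orbT.
have [||c] := @IVT R Phi 0 X r (le_trans ler01 X1).
- exact/continuous_subspaceT/young_continuous.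
- by rewrite young0 min_l ?young_ge0// max_r ?young_ge0// r0.
by rewrite in_itv /= => /andP[c0 _] <-; exists c.
Qed.

Lemma young_lt_iff x y : 0 <= x -> 0 <= y -> (Phi x < Phi y) = (x < y).
Proof.
move=> x0 y0; apply/idP/idP; last exact: young_lt.
by apply: contraTT; rewrite -!leNgt; exact: young_le.
Qed.

Lemma young_le_iff x y : 0 <= x -> 0 <= y -> (Phi x <= Phi y) = (x <= y).
Proof. by move=> x0 y0; rewrite !leNgt young_lt_iff. Qed.

Lemma young_invE r : 0 <= r ->
  exists x, [/\ 0 <= x, Phi x = r & young_inv Phi r%:E = x%:E].
Proof.
move=> r0; have [x x0 <-] := young_surjective r0.
exists x; split => //; congr EFin; rewrite pinvKV//; last by rewrite inE.
move=> a b /[!inE] /= a0 b0 ab; apply/eqP; rewrite eq_le.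
by rewrite -(young_le_iff a0 b0) -(young_le_iff b0 a0) ab lexx.
Qed.

Lemma young_inv_ge0 (t : \bar R) : (0 <= t)%E -> (0 <= young_inv Phi t)%E.
Proof.
case: t => [r||]//; rewrite lee_fin => r0.
by have [x [x0 _ ->]] := young_invE r0; rewrite lee_fin.
Qed.

Lemma le_young_inv e (t : \bar R) : 0 <= e -> (0 <= t)%E ->
  (e%:E <= young_inv Phi t)%E = ((Phi e)%:E <= t)%E.
Proof.
move=> e0; case: t => [r||]//; last by move=> _; rewrite !leey.
rewrite lee_fin => r0; have [x [x0 <- ->]] := young_invE r0.
by rewrite !lee_fin young_le_iff.
Qed.

(** By superlinear growth [z * y - Phi z] is nonpositive for large [z], while
    it is 0 at [z = 0]; hence the supremum is a maximum over a compact
    interval. *)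
Lemma young_conjugate_max y : 0 <= y -> exists x, [/\ 0 <= x,
  (forall z, 0 <= z -> z * y - Phi z <= x * y - Phi x) &
  complementary Phi y = x * y - Phi x].
Proof.
move=> y0; have [cont _ _ _ [_ sup]] := hPhi.
have [X X0 hX] : exists2 X, 0 <= X & forall z, X <= z -> z * y <= Phi z.
  have /cvgryPge /(_ y) [M [Mr hM]] := sup.
  exists (Num.max 1 (M + 1)); first by rewrite le_max ler01.
  move=> z; rewrite ge_max => /andP[z1 zM].
  have z0 : 0 < z := lt_le_trans ltr01 z1.
  have := hM z; rewrite ler_pdivlMr// mulrC; apply.
  by apply: lt_le_trans zM; rewrite ltrDl.
have [|x xX xmax] := @EVT_max R (fun z => z * y - Phi z) 0 X X0.
  apply: continuous_subspaceT => z; apply: cvgB; last exact: cont.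
  by apply: cvgM; [exact: cvg_id|exact: cvg_cst].
have x0 : 0 <= x by move: xX; rewrite in_itv /= => /andP[].
have max z : 0 <= z -> z * y - Phi z <= x * y - Phi x.
  move=> z0; have [zX|Xz] := leP z X.
    by apply: xmax; rewrite in_itv /= z0.
  apply: (@le_trans _ _ 0); first by rewrite subr_le0 hX// ltW.
  by have := xmax 0; rewrite in_itv /= lexx X0 mul0r young0 subr0; apply.
exists x; split => //; rewrite /complementary ger0_norm//.
apply/eqP; rewrite eq_le; apply/andP; split.
  apply: sup_le_ub; first by exists (x * y - Phi x), x.
  by move=> _ [z /= z0 <-]; exact: max.
apply: ub_le_sup; last by exists x.
by exists (x * y - Phi x) => _ [z /= z0 <-]; exact: max.
Qed.

(** Equality in Young's inequality along a measurable curve.  Any selection of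
    maximizers is nondecreasing: adding the two maximality inequalities at
    [a < b] gives [(p a - p b) * (b - a) <= 0]. *)
Lemma young_equality : exists p : R -> R, [/\ forall y, 0 <= p y,
  {homo p : x y / x <= y} &
  forall y, 0 <= y -> y * p y = Phi (p y) + complementary Phi y].
Proof.
have /choice[s sP] : forall y : R, exists x, 0 <= y -> [/\ 0 <= x,
    (forall z, 0 <= z -> z * y - Phi z <= x * y - Phi x) &
    complementary Phi y = x * y - Phi x].
  move=> y; have [y0|_] := leP 0 y.
    by have [x h] := young_conjugate_max y0; exists x.
  by exists 0.
have max0 y : 0 <= Num.max 0 y :> R by rewrite le_max lexx.
exists (fun y => s (Num.max 0 y)); split.
- by move=> y; case: (sP _ (max0 y)).
- move=> x y xy.
  have : Num.max 0 x <= Num.max 0 y by rewrite ge_max max0 /= le_max xy orbT.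
  move: (max0 x) (max0 y); set a := Num.max 0 x; set b := Num.max 0 y => a0 b0.
  rewrite le_eqVlt => /predU1P[->//|ab].
  have [sa0 amax _] := sP _ a0; have [sb0 bmax _] := sP _ b0.
  have := amax _ sb0; have := bmax _ sa0 => h1 h2.
  rewrite leNgt; apply/negP => lt.
  have : 0 < (s a - s b) * (b - a) by rewrite mulr_gt0 ?subr_gt0.
  lra.
- move=> y y0; rewrite max_r//; have [_ _ ->] := sP _ y0.
  by rewrite addrC subrK mulrC.
Qed.
End YoungFacts.

(** * Complex functions, modulars and the Luxemburg norm *)

Section ComplexMeasurable.
Context {R : realType} d {T : measurableType d}.
Implicit Types f g : T -> R[i].

Lemma normc_ge0 (z : R[i]) : 0 <= Normc.normc z.
Proof. by case: z => a b /=; exact: sqrtr_ge0. Qed.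

Lemma modulus_ge0 f x : 0 <= modulus f x.
Proof. exact: normc_ge0. Qed.

Lemma Re_le_normc (z : R[i]) : `|complex.Re z| <= Normc.normc z.
Proof.
by case: z => a b /=; rewrite -sqrtr_sqr ler_wsqrtr// lerDl sqr_ge0.
Qed.

Lemma Im_le_normc (z : R[i]) : `|complex.Im z| <= Normc.normc z.
Proof.
by case: z => a b /=; rewrite -sqrtr_sqr ler_wsqrtr// lerDr sqr_ge0.
Qed.

Lemma normc_real (a : R) : Normc.normc (real_complex R a) = `|a|.
Proof. by rewrite /= expr0n /= addr0 sqrtr_sqr. Qed.

Lemma normc_le_sum (z : R[i]) :
  Normc.normc z <= `|complex.Re z| + `|complex.Im z|.
Proof.
case: z => a b /=.
rewrite -[leRHS]ger0_norm ?addr_ge0// -sqrtr_sqr ler_wsqrtr//.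
rewrite sqrrD !real_normK ?num_real// addrAC lerDl.
by rewrite mulrn_wge0// mulr_ge0.
Qed.

Lemma normcB_le (z w : R[i]) :
  Normc.normc (z - w) <= Normc.normc z + Normc.normc w.
Proof. by rewrite -[Normc.normc w](@normcN R); exact: (@le_normcD R). Qed.

Lemma normc_triangle (a b h : R[i]) :
  Normc.normc (a - b) <= Normc.normc (a - h) + Normc.normc (b - h).
Proof.
have -> : a - b = (a - h) - (b - h) by rewrite opprB addrA subrK.
exact: normcB_le.
Qed.

Lemma modulusE f x : modulus f x =
  Num.sqrt (complex.Re (f x) ^+ 2 + complex.Im (f x) ^+ 2).
Proof. by rewrite /modulus; case: (f x). Qed.

Lemma measurable_modulus f : measurable_complex f ->
  measurable_fun [set: T] (modulus f).
Proof.
move=> [mRe mIm].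
rewrite (_ : modulus f = fun x =>
    Num.sqrt (complex.Re (f x) ^+ 2 + complex.Im (f x) ^+ 2)).
  apply: (@measurableT_comp _ _ _ _ _ _ (@Num.sqrt R)).
    apply: continuous_measurable_fun; exact: sqrt_continuous.
  by apply: measurable_funD; exact: measurable_funX.
by apply/funext => x; rewrite /modulus; case: (f x).
Qed.

Lemma measurable_complexB f g : measurable_complex f -> measurable_complex g ->
  measurable_complex (f \- g).
Proof.
move=> [fr fi] [gr gi]; split.
  rewrite [X in measurable_fun _ X](_ : _ =
    (fun x => complex.Re (f x)) \- (fun x => complex.Re (g x))).
    exact: measurable_funB.
  by apply/funext => x /=; case: (f x); case: (g x).
rewrite [X in measurable_fun _ X](_ : _ =
  (fun x => complex.Im (f x)) \- (fun x => complex.Im (g x))).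
  exact: measurable_funB.
by apply/funext => x /=; case: (f x); case: (g x).
Qed.

Lemma measurable_complexM f g : measurable_complex f -> measurable_complex g ->
  measurable_complex (f \* g).
Proof.
move=> [fr fi] [gr gi]; split.
  rewrite [X in measurable_fun _ X](_ : _ = fun x =>
    complex.Re (f x) * complex.Re (g x) - complex.Im (f x) * complex.Im (g x)).
    by apply: measurable_funB; exact: measurable_funM.
  by apply/funext => x /=; case: (f x); case: (g x).
rewrite [X in measurable_fun _ X](_ : _ = fun x =>
  complex.Re (f x) * complex.Im (g x) + complex.Im (f x) * complex.Re (g x)).
  by apply: measurable_funD; exact: measurable_funM.
by apply/funext => x /=; case: (f x); case: (g x).
Qed.

Lemma measurable_complex_real (r : T -> R) : measurable_fun [set: T] r ->
  measurable_complex (fun x => real_complex R (r x)).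
Proof. by move=> mr; split => //=; exact: measurable_cst. Qed.

End ComplexMeasurable.

Lemma trivIset_notin (T : Type) (A : nat -> set T) m n x :
  trivIset [set: nat] A ->
  m != n -> A n x -> ~ A m x.
Proof.
move=> tA mn Anx Amx; move/eqP: mn; apply; apply: tA => //.
by exists x.
Qed.

Section Modular.
Context {R : realType} d {T : measurableType d}.
Variable mu : {measure set T -> \bar R}.
Variable Phi : R -> R.
Hypothesis hPhi : young_function Phi.
Implicit Types f g h : T -> R[i].

Lemma measurable_young_comp (r : T -> R) : measurable_fun [set: T] r ->
  measurable_fun [set: T] (fun x => (Phi (r x))%:E).
Proof.
move=> mr; apply/measurable_EFinP.
exact: (measurableT_comp (young_measurable hPhi)).
Qed.

(** The integral whose sublevel set [<= 1] defines the Luxemburg norm,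
    localised to [D].  Unlike the norm it is additive in [D], which makes it
    the convenient quantity for all estimates. *)
Definition modular (D : set T) f (k : R) :=
  (\int[mu]_(x in D) (Phi (modulus f x / k))%:E)%E.

Lemma measurable_modular_integrand f k : measurable_complex f ->
  measurable_fun [set: T] (fun x => (Phi (modulus f x / k))%:E).
Proof.
move=> mf; apply: measurable_young_comp.
by apply: measurable_funM => //; exact: measurable_modulus.
Qed.

Lemma modular_ge0 D f k : (0 <= modular D f k)%E.
Proof. by apply: integral_ge0 => x _; rewrite lee_fin (young_ge0 hPhi). Qed.

Lemma modular_le (D : set T) f k k' : measurable D -> measurable_complex f ->
  0 < k -> k <= k' -> (modular D f k' <= modular D f k)%E.
Proof.
move=> mD mf k0 kk'; have k'0 : 0 < k' := lt_le_trans k0 kk'.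
apply: ge0_le_integral => //.
- by move=> x _; rewrite lee_fin (young_ge0 hPhi).
- exact/measurable_funTS/measurable_modular_integrand.
- exact/measurable_funTS/measurable_modular_integrand.
- move=> x _; rewrite lee_fin young_le// ?divr_ge0 ?modulus_ge0// ?(ltW k'0)//.
  by rewrite ler_wpM2l ?modulus_ge0// lef_pV2.
Qed.

Lemma modular_scale (D : set T) f k t : measurable D -> measurable_complex f ->
  1 <= t -> (t%:E * modular D f (t * k) <= modular D f k)%E.
Proof.
move=> mD mf t1; have t0 : 0 < t := lt_le_trans ltr01 t1.
rewrite /modular -ge0_integralZl//; last 3 first.
- exact/measurable_funTS/measurable_modular_integrand.
- by move=> x _; rewrite lee_fin (young_ge0 hPhi).
- by rewrite lee_fin ltW.
apply: ge0_le_integral => //.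
- by move=> x _; apply: mule_ge0; rewrite lee_fin; [exact: ltW|exact: young_ge0].
- by apply: measurable_funeM; exact/measurable_funTS/measurable_modular_integrand.
- exact/measurable_funTS/measurable_modular_integrand.
- move=> x _; rewrite -EFinM lee_fin.
  have -> : modulus f x / k = t * (modulus f x / (t * k)).
    by rewrite invfM mulrCA mulVKf// gt_eqF.
  exact: young_scale_ge.
Qed.

(** If the modular is finite at some scale, dividing the function by [1 + r],
    where [r] is its value, divides the modular by at least [1 + r]. *)
Lemma in_orlicz_modular f : in_orlicz mu Phi f ->
  exists2 k, 0 < k & (modular setT f k <= 1)%E.
Proof.
move=> [mf [k k0 fin]].
have : (modular setT f k^-1 < +oo)%E.
  by rewrite /modular invrK; under eq_integral do rewrite mulrC.
case E: (modular setT f k^-1) (modular_ge0 setT f k^-1) => [r||]// r0 _.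
pose t := 1 + r; have r0' : 0 <= r by rewrite lee_fin in r0.
have t1 : 1 <= t by rewrite /t lerDl.
exists (t * k^-1); first by rewrite mulr_gt0 ?invr_gt0// (lt_le_trans ltr01).
have := modular_scale k^-1 measurableT mf t1; rewrite E.
case: (modular setT f _) (modular_ge0 setT f (t * k^-1)) => [q||]//; last first.
  by rewrite gt0_muley ?lte_fin ?(lt_le_trans ltr01 t1).
rewrite -EFinM !lee_fin => q0 tq.
have : t * q <= t * 1 by rewrite mulr1; apply: le_trans tq _; rewrite /t lerDr.
by rewrite ler_pM2l// (lt_le_trans ltr01).
Qed.

Lemma modular_in_orlicz f k : measurable_complex f -> 0 < k ->
  (modular setT f k < +oo)%E -> in_orlicz mu Phi f.
Proof.
move=> mf k0 fk; split => //; exists k^-1; first by rewrite invr_gt0.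
by under eq_integral do rewrite mulrC.
Qed.

Lemma orlicz_norm_le f k : 0 < k -> (modular setT f k <= 1)%E ->
  orlicz_norm mu Phi f <= k.
Proof.
move=> k0 fk; apply: ge_inf; last by split.
by exists 0 => x [x0 _]; exact: ltW.
Qed.

Lemma orlicz_norm_ge0 f : 0 <= orlicz_norm mu Phi f.
Proof.
rewrite /orlicz_norm; set S := [set _ | _].
have [->|/set0P S0] := eqVneq S set0; first by rewrite inf0.
by apply: lb_le_inf => // x [x0 _]; exact: ltW.
Qed.

(** Membership in the Orlicz space matters here: the infimum of the empty set
    is 0, so a small value of the norm would otherwise carry no information. *)
Lemma orlicz_norm_lt f k : in_orlicz mu Phi f -> orlicz_norm mu Phi f < k ->
  (modular setT f k <= 1)%E.
Proof.
move=> fO; have mf := fO.1; have [k1 k10 fk1] := in_orlicz_modular fO.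
move=> /inf_lt[|k' [k'0 fk'] k'k].
  by exists k1.
apply: le_trans fk'; apply: modular_le => //.
exact: ltW.
Qed.

(** Convexity of [Phi] at a midpoint replaces the triangle inequality of the
    norm; [h = 0] gives the bound for a difference of two functions. *)
Lemma modular_triangle (D : set T) (a b h : T -> R[i]) k : measurable D ->
  measurable_complex a -> measurable_complex b -> measurable_complex h ->
  0 < k ->
  (modular D (a \- b)%R (k + k) <=
   (2^-1)%:E * (modular D (a \- h)%R k + modular D (b \- h)%R k))%E.
Proof.
move=> mD ma mb mh k0.
have mah := measurable_complexB ma mh; have mbh := measurable_complexB mb mh.
have mab := measurable_complexB ma mb.
rewrite /modular -ge0_integralD//; last 4 first.
- by move=> x _; rewrite lee_fin (young_ge0 hPhi).
- exact/measurable_funTS/measurable_modular_integrand.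
- by move=> x _; rewrite lee_fin (young_ge0 hPhi).
- exact/measurable_funTS/measurable_modular_integrand.
rewrite -ge0_integralZl//; last 2 first.
- by apply: emeasurable_funD;
    exact/measurable_funTS/measurable_modular_integrand.
- by move=> x _; rewrite adde_ge0// lee_fin (young_ge0 hPhi).
apply: ge0_le_integral => //.
- by move=> x _; rewrite lee_fin (young_ge0 hPhi).
- exact/measurable_funTS/measurable_modular_integrand.
- by apply: measurable_funeM; apply: emeasurable_funD;
    exact/measurable_funTS/measurable_modular_integrand.
move=> x _; rewrite -EFinD -EFinM lee_fin [leRHS]mulrC.
apply: le_trans (young_half hPhi _ _).
apply: young_le => //; first by rewrite divr_ge0 ?modulus_ge0// addr_ge0// ltW.
rewrite -mulrDl -mulrA -invfM mulr_natr mulr2n.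
rewrite ler_wpM2r ?invr_ge0 ?addr_ge0 ?(ltW k0)//.
exact: normc_triangle.
Qed.

Lemma in_orliczB f g : in_orlicz mu Phi f -> in_orlicz mu Phi g ->
  in_orlicz mu Phi (f \- g).
Proof.
move=> fO gO; have mf := fO.1; have mg := gO.1.
have [k1 k10 fk1] := in_orlicz_modular fO.
have [k2 k20 gk2] := in_orlicz_modular gO.
pose k := Num.max k1 k2.
have k0 : 0 < k by rewrite lt_max k10.
have m0 : measurable_complex (fun _ : T => 0 : R[i]).
  by split; exact: measurable_cst.
have f0E h : h \- (fun=> 0) = h by apply/funext => x /=; rewrite subr0.
have k1k : k1 <= k by rewrite le_max lexx.
have k2k : k2 <= k by rewrite le_max lexx orbT.
apply: (@modular_in_orlicz _ (k + k)); rewrite ?addr_gt0//.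
  exact: measurable_complexB.
apply: le_lt_trans (modular_triangle measurableT mf mg m0 k0) _.
rewrite !f0E; apply: lte_mul_pinfty; rewrite ?lee_fin ?invr_ge0//.
apply: lte_add_pinfty; apply: (@le_lt_trans _ _ 1%E); rewrite ?ltry//.
  by apply: le_trans fk1; exact: modular_le.
by apply: le_trans gk2; exact: modular_le.
Qed.

(** The height at which the indicator function of [A] has modular 1. *)
Lemma normalizing_height (A : set T) : (0 < mu A < +oo)%E ->
  exists a, 0 < a /\ ((Phi a)%:E * mu A = 1)%E.
Proof.
move=> /andP[A0 Afin].
have Ar : mu A \is a fin_num by rewrite ge0_fin_numE.
have fA0 : 0 < fine (mu A) by rewrite fine_gt0// A0.
have [a a0 Pa] := young_surjective hPhi (ltW (divr_gt0 ltr01 fA0)).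
exists a; split; last first.
  by rewrite Pa -(fineK Ar) -EFinM /= div1r mulVf// gt_eqF.
rewrite lt_neqAle a0 andbT; apply/eqP => a00.
move: Pa; rewrite -a00 (young0 hPhi) => /esym/eqP.
by rewrite mul1r invr_eq0 gt_eqF.
Qed.

(** If a subsequence converged, two late members [m != n] would have images
    within [delta] of each other in the Luxemburg sense.  On [S m] the image
    of [f n] vanishes, so the image of [f m] alone would have modular at most 1
    there at scale [delta]. *)
Lemma not_orlicz_compact (A : (T -> R[i]) -> T -> R[i]) (f : nat -> T -> R[i])
    (S : nat -> set T) (delta : R) : 0 < delta ->
  (forall f, in_orlicz mu Phi f -> in_orlicz mu Phi (A f)) ->
  (forall n, measurable (S n)) -> (forall n, measurable_complex (f n)) ->
  (forall n, modular setT (f n) 1 <= 1)%E ->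
  (forall m n, m != n -> {ae mu, forall x, S n x -> A (f m) x = 0}) ->
  (forall n, 1 < modular (S n) (A (f n)) delta)%E ->
  ~ orlicz_compact mu Phi A.
Proof.
move=> delta0 AO mS mf f1 Af0 Afn cpt.
have fO n : in_orlicz mu Phi (f n).
  by apply: (@modular_in_orlicz _ 1) => //; exact: le_lt_trans (f1 n) (ltry 1).
have [|s [h [smono hO cvg]]] := cpt f fO.
  by exists 1 => n; exact: orlicz_norm_le.
have [N hN] : exists N, forall n, (N <= n)%N ->
    orlicz_norm mu Phi (A (f (s n)) \- h) < delta / 2.
  have d20 : 0 < delta / 2 by rewrite divr_gt0.
  have /cvgrPdist_lt /(_ _ d20)[N _ hN] := cvg.
  exists N => n /hN /=; rewrite sub0r normrN ger0_norm//.
  exact: orlicz_norm_ge0.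
set m := s N; set n := s N.+1.
have mn : n != m by rewrite gtn_eqF// smono.
have mod1 j : (N <= j)%N ->
    (modular (S m) (A (f (s j)) \- h)%R (delta / 2) <= 1)%E.
  move=> /hN /(orlicz_norm_lt (in_orliczB (AO _ (fO _)) hO)).
  apply: le_trans; apply: ge0_subset_integral => //.
  - apply: measurable_modular_integrand; apply: measurable_complexB.
      exact: (AO _ (fO _)).1.
    exact: hO.1.
  - by move=> x _; rewrite lee_fin (young_ge0 hPhi).
have mA j := (AO _ (fO j)).1.
have := @modular_triangle (S m) (A (f m)) (A (f n)) h (delta / 2) (mS m)
  (mA m) (mA n) hO.1; rewrite divr_gt0// => /(_ erefl).
rewrite -splitr; apply/negP; rewrite -ltNge.
apply: (@le_lt_trans _ _ 1%E).
  apply: (@le_trans _ _ ((2^-1)%:E * (1 + 1))%E).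
    by rewrite lee_pmul2l ?lte_fin// leeD// mod1.
  by rewrite -EFinD -EFinM lee_fin -(natrD R 1 1) mulVf.
apply: lt_le_trans (Afn m) _.
apply: ae_ge0_le_integral => //.
- by move=> x _; rewrite lee_fin (young_ge0 hPhi).
- exact/measurable_funTS/measurable_modular_integrand.
- by move=> x _; rewrite lee_fin (young_ge0 hPhi).
- apply/measurable_funTS/measurable_modular_integrand.
  exact: measurable_complexB.
- apply: filterS (Af0 n m mn) => x An0 Smx.
  by rewrite /modulus /= An0// subr0.
Qed.

End Modular.

(** * Conditional expectations of complex functions *)

Section ComplexConditionalExpectation.
Context (R : realType) (d : measure_display) (T : measurableType d).
Variables (mu : {measure set T -> \bar R}) (G : set (set T)).
Hypothesis hG : sigma_algebra [set: T] G.
Hypothesis hGsub : G `<=` (measurable : set (set T)).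
Hypothesis hGfin : sigma_finite [set: g_sigma_algebraType G] mu.
Local Notation GT := (g_sigma_algebraType G).

Lemma condexpR_scale_on (A : set T) (a : R) (f g : T -> R) : G A ->
  measurable_fun [set: T] f -> measurable_fun [set: T] g -> 0 <= a ->
  (forall x, A x -> g x = a * f x) ->
  {ae mu, forall x, A x -> condexpR mu G g x = a * condexpR mu G f x}.
Proof.
move=> GA mf mg a0 gf.
have pos : {ae mu, forall x, A x -> condexp mu G (EFin \o (g^\+)%R) x =
    a%:E * condexp mu G (EFin \o (f^\+)%R) x}%E.
  apply: condexp_scale_on => //; try exact: measurable_funrpos.
  by move=> x Ax; rewrite /funrpos gf// -[0 in LHS](mulr0 a) maxr_pMr.
have neg : {ae mu, forall x, A x -> condexp mu G (EFin \o (g^\-)%R) x =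
    a%:E * condexp mu G (EFin \o (f^\-)%R) x}%E.
  apply: condexp_scale_on => //; try exact: measurable_funrneg.
  by move=> x Ax; rewrite /funrneg gf// -mulrN -[0 in LHS](mulr0 a) maxr_pMr.
have fineZ (y : \bar R) : fine (a%:E * y) = a * fine y.
  have [->|an0] := eqVneq a 0; first by rewrite mul0e mul0r.
  have ap : (0 < a%:E)%E by rewrite lte_fin lt_neqAle eq_sym an0.
  by case: y => [r||]; rewrite ?gt0_muley ?gt0_muleNy// mulr0.
apply: filterS2 pos neg => x px nx Ax.
by rewrite /condexpR px// nx// !fineZ -mulrBr.
Qed.

Lemma condexpC_scale_on (A : set T) (a : R) (f g : T -> R[i]) : G A ->
  measurable_complex f -> measurable_complex g -> 0 <= a ->
  (forall x, A x -> g x = real_complex R a * f x) ->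
  {ae mu, forall x, A x ->
    condexpC mu G g x = real_complex R a * condexpC mu G f x}.
Proof.
move=> GA [fr fi] [gr gi] a0 gf.
have re := @condexpR_scale_on A a _ _ GA fr gr a0.
have im := @condexpR_scale_on A a _ _ GA fi gi a0.
apply: filterS2 (re _) (im _) => [x rx ix Ax|x Ax|x Ax].
- rewrite /condexpC rx// ix//; apply/eqP.
  by rewrite eq_complex /= !mul0r subr0 addr0 !eqxx.
- by rewrite gf//; case: (f x) => p q /=; rewrite mul0r subr0.
- by rewrite gf//; case: (f x) => p q /=; rewrite mul0r addr0.
Qed.

Lemma measurable_condexpR (f : T -> R) : measurable_fun [set: T] f ->
  measurable_fun [set: GT] (condexpR mu G f : GT -> R).
Proof.
move=> mf; apply: measurable_funB; apply: measurableT_comp => //.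
  have [] // := @condexpP _ _ _ mu G hG hGsub hGfin f^\+.
  exact: measurable_funrpos.
have [] // := @condexpP _ _ _ mu G hG hGsub hGfin f^\-.
exact: measurable_funrneg.
Qed.

Lemma sub_modulus_ge (f : T -> R[i]) e : measurable_complex f ->
  G [set x | e <= modulus (condexpC mu G f) x].
Proof.
move=> [fr fi]; apply/(measurable_subP hG).
have m : measurable_fun [set: GT] (modulus (condexpC mu G f) : GT -> R).
  by apply: measurable_modulus; split; exact: measurable_condexpR.
rewrite [X in measurable X](_ : _ =
    [set: GT] `&` modulus (condexpC mu G f) @^-1` `[e, +oo[).
  exact: m.
by rewrite setTI; apply/seteqP; split => x /=; rewrite in_itv /= andbT.
Qed.

End ComplexConditionalExpectation.

(** * Compactness and the conditional mean of u *)

Section CompactMean.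
Context (R : realType) (d : measure_display) (T : measurableType d).
Variables (mu : {measure set T -> \bar R}) (G : set (set T)).
Hypothesis hG : sigma_algebra [set: T] G.
Hypothesis hGsub : G `<=` (measurable : set (set T)).
Hypothesis hGfin : sigma_finite [set: g_sigma_algebraType G] mu.
Variable Phi : R -> R.
Hypothesis hPhi : young_function Phi.
Variable u : T -> R[i].
Hypothesis hu : measurable_complex u.
Hypothesis hT : condexp_mul_bounded mu G Phi u.

(** The test functions are normalised indicators of disjoint sets [A n] on
    which the conditional mean has modulus at least [eps]. *)
Lemma compact_finitely_many_atoms_condexp (eps : R) : 0 < eps ->
  orlicz_compact mu Phi (condexp_mul mu G u) ->
  finitely_many_atoms mu G [set x | eps <= modulus (condexpC mu G u) x].
Proof.
move=> eps0 cpt; apply: contrapT => nfin.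
have [A [GA AS muA tA]] := not_finitely_many_atoms hG hGsub hGfin
  (sub_modulus_ge hG hGsub hGfin eps hu) nfin.
have mA n : measurable (A n) := hGsub (GA n).
have [a /all_and2[a0 aA]] := choice (fun n => normalizing_height hPhi (muA n)).
pose f n x := real_complex R (a n * \1_(A n) x).
have mf n : measurable_complex (f n).
  apply: measurable_complex_real; apply: measurable_funM.
    exact: measurable_cst.
  exact/measurable_indicP.
have fE n x : A n x -> f n x = real_complex R (a n).
  by move=> Ax; rewrite /f indicE mem_set// mulr1.
have fE0 n x : ~ A n x -> f n x = 0.
  by move=> Ax; rewrite /f indicE memNset// mulr0.
have muf n := measurable_complexM hu (mf n).
have f1 n : (modular mu Phi setT (f n) 1 <= 1)%E.
  rewrite /modular -(aA n) -integral_cst// [leRHS]integral_mkcond.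
  rewrite le_eqVlt; apply/orP; left; apply/eqP; apply: eq_integral => x _.
  rewrite patchE; case: ifPn => [|/negP].
    by rewrite inE /modulus => /fE ->; rewrite normc_real divr1 gtr0_norm.
  rewrite inE /modulus => /fE0 ->.
  by rewrite divr1 Normc.normc0 (young0 hPhi).
have fO n : in_orlicz mu Phi (f n).
  by apply: (@modular_in_orlicz _ _ _ _ _ _ 1) => //;
    exact: le_lt_trans (f1 n) (ltry 1).
apply: (@not_orlicz_compact _ _ _ mu Phi hPhi _ f A (eps / 2) _ _ mA mf) cpt.
- by rewrite divr_gt0.
- exact: hT.2.1.
- exact: f1.
- move=> m n mn.
  apply: filterS (@condexpC_scale_on _ _ _ mu G hG hGsub hGfin (A n) 0 u _
    (GA n) hu (muf m) (lexx 0) _) => [x E Ax|x Ax].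
    by rewrite /condexp_mul E// mul0r.
  by rewrite /= fE0 ?mulr0 ?mul0r//; exact: trivIset_notin Ax.
- move=> n; apply: (@lt_le_trans _ _ (\int[mu]_(x in A n) (Phi (2 * a n))%:E)%E).
    rewrite integral_cst//.
    apply: (@lt_le_trans _ _ ((2 * Phi (a n))%:E * mu (A n))%E).
      by rewrite EFinM -muleA aA mule1 lte_fin ltr1n.
    by rewrite lee_wpmul2r// lee_fin; apply: young_scale_ge => //; rewrite ler1n.
  apply: ae_ge0_le_integral => //.
  + by move=> x _; rewrite lee_fin (young_ge0 hPhi).
  + by move=> x _; rewrite lee_fin (young_ge0 hPhi).
  + apply/measurable_funTS/(measurable_modular_integrand hPhi).
    exact: (hT.2.1 _ (fO n)).1.
  apply: filterS (@condexpC_scale_on _ _ _ mu G hG hGsub hGfin (A n) (a n) u _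
    (GA n) hu (muf n) (ltW (a0 n)) _) => [x E Ax|x Ax]; last first.
    by rewrite /= fE// mulrC.
  rewrite lee_fin young_le//; first by rewrite mulr_ge0// ltW.
  rewrite /modulus /condexp_mul E// Normc.normcM normc_real gtr0_norm//.
  rewrite ler_pdivlMr ?divr_gt0//.
  have -> : 2 * a n * (eps / 2) = a n * eps by field.
  by rewrite ler_pM2l//; exact: AS Ax.
Qed.

End CompactMean.

(** * Extremal functions for the conditional duality *)

Section ExtremalFunctions.
Context (R : realType) (d : measure_display) (T : measurableType d).
Variables (mu : {measure set T -> \bar R}) (G : set (set T)).
Hypothesis hG : sigma_algebra [set: T] G.
Hypothesis hGsub : G `<=` (measurable : set (set T)).
Hypothesis hGfin : sigma_finite [set: g_sigma_algebraType G] mu.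
Variable Phi : R -> R.
Hypothesis hPhi : young_function Phi.

(** A Jensen-type bound that avoids subgradients: [Phi] lies above the line
    [z |-> (z / b - 1) * Phi b], by convexity for [z >= b] and by nonnegativity
    for [z < b].  Integrating this line gives the claim. *)
Lemma modular_ge_of_mean (D : set T) (f : T -> R[i]) b delta :
  measurable D -> (mu D < +oo)%E -> measurable_complex f ->
  0 < b -> 0 < delta ->
  ((2 * b * delta)%:E * mu D <= \int[mu]_(x in D) (modulus f x)%:E)%E ->
  ((Phi b)%:E * mu D <= modular mu Phi D f delta)%E.
Proof.
move=> mD Dfin mf b0 delta0 mean.
have mPf := measurable_modular_integrand hPhi delta mf.
have mf' : measurable_fun D (fun x => (modulus f x)%:E).
  exact/measurable_funTS/measurable_EFinP/measurable_modulus.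
have muD : mu D \is a fin_num by rewrite ge0_fin_numE.
have Pb := young_gt0 hPhi b0.
pose C := Phi b / (b * delta).
have C0 : 0 < C by rewrite divr_gt0 ?mulr_gt0.
suff key : (C%:E * \int[mu]_(x in D) (modulus f x)%:E <=
    modular mu Phi D f delta + (Phi b)%:E * mu D)%E.
  rewrite -(@leeD2rE _ ((Phi b)%:E * mu D)%E) ?fin_numM//.
  apply: le_trans key.
  have := @lee_wpmul2l R C%:E _ _ _ mean; rewrite lee_fin (ltW C0) => /(_ erefl).
  apply: le_trans; rewrite muleA -EFinM -ge0_muleDl ?lee_fin ?(ltW Pb)//.
  rewrite -EFinD (_ : C * _ = Phi b + Phi b)//.
  by rewrite /C; field; rewrite !gt_eqF.
rewrite -ge0_integralZl//; last 2 first.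
- by move=> x _; rewrite lee_fin modulus_ge0.
- by rewrite lee_fin ltW.
rewrite -integral_cst// /modular -ge0_integralD//; last 3 first.
- by move=> x _; rewrite lee_fin (young_ge0 hPhi).
- exact: measurable_funTS.
- by move=> x _; rewrite lee_fin (young_ge0 hPhi).
apply: ge0_le_integral => //.
- by move=> x _; rewrite mule_ge0 ?lee_fin ?modulus_ge0// ltW.
- exact: measurable_funeM.
- by apply: emeasurable_funD => //; exact: measurable_funTS.
move=> x _ /=; rewrite -EFinM -EFinD lee_fin.
set z := modulus f x / delta.
have z0 : 0 <= z by rewrite divr_ge0 ?modulus_ge0// ltW.
have -> : C * modulus f x = z / b * Phi b.
  by rewrite /C /z; field; rewrite !gt_eqF.
have [bz|zb] := leP b z.
  have zb1 : 1 <= z / b by rewrite ler_pdivlMr// mul1r.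
  have := young_scale_ge hPhi b zb1; rewrite divfK ?gt_eqF// => h.
  by apply: le_trans h _; rewrite lerDl ltW.
apply: (@le_trans _ _ (1 * Phi b)).
  by rewrite ler_pM2r// ler_pdivrMr// mul1r ltW.
by rewrite mul1r lerDr (young_ge0 hPhi).
Qed.

(** For nonnegative [r] the conditional expectation is almost everywhere real,
    finite on [A], and has the same integral over [A] as [r]. *)
Lemma integral_modulus_condexp_ge (A : set T) (r : T -> R) : G A ->
  measurable_fun [set: T] r -> (forall x, 0 <= r x) ->
  (\int[mu]_(x in A) (r x)%:E < +oo)%E ->
  (\int[mu]_(x in A) (r x)%:E <= \int[mu]_(x in A)
    (modulus (condexpC mu G (fun x => real_complex R (r x))) x)%:E)%E.
Proof.
move=> GA mr r0 rfin; have mA := hGsub GA.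
have [mE _ EE] := condexpP hG hGsub hGfin mr r0.
have mE' := measurable_fun_sub hG hGsub mE.
have E0 x : (0 <= condexp mu G (EFin \o r) x)%E by exact: condexp_ge0.
have Efin : mu.-integrable A (condexp mu G (EFin \o r)).
  apply/integrableP; split; first exact: measurable_funTS.
  by under eq_integral do rewrite gee0_abs//; rewrite -EE.
have rp : r^\+ = r by apply/funext => x; rewrite /funrpos max_l.
pose o : T -> R := cst 0.
have rn : r^\- = o by apply/funext => x; rewrite /funrneg max_r// oppr_le0.
have zero : {ae mu, forall x, [set: T] x ->
    condexp mu G (EFin \o o) x = (0%:E * condexp mu G (EFin \o o) x)%E}.
  apply: (@condexp_scale_on _ _ _ mu G hG hGsub hGfin setT 0 o o) => //.
    exact: sub_setT.
  by move=> x _; rewrite mul0r.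
rewrite [leLHS]EE//; apply: ae_ge0_le_integral => //.
- exact: measurable_funTS.
- by move=> x _; rewrite lee_fin modulus_ge0.
- apply/measurable_funTS/measurable_EFinP/measurable_modulus; split;
    apply: (measurable_fun_sub hG hGsub);
    exact: (measurable_condexpR hG hGsub hGfin).
apply: filterS2 zero (integrable_ae mA Efin) => x z0 /[swap] Ax /(_ Ax) fx.
rewrite -(fineK fx) lee_fin /modulus.
apply: le_trans (Re_le_normc _); apply: le_trans (ler_norm _).
by rewrite /= /condexpR rp rn z0// mul0e subr0.
Qed.

Variable u : T -> R[i].
Hypothesis hu : measurable_complex u.
Local Notation Psi := (complementary Phi).
Hypothesis hPsi : young_function Psi.

(** Monotone convergence; the truncation makes all later integrals finite,
    although the integral of [Psi u] may be infinite. *)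
Lemma truncation_captures (A : set T) (m : R) : measurable A ->
  (m%:E < \int[mu]_(x in A) (Psi (modulus u x))%:E)%E ->
  exists k : nat, (m%:E < \int[mu]_(x in A)
    (Psi (if (modulus u x <= k%:R)%R then modulus u x else 0))%:E)%E.
Proof.
move=> mA mlt; apply: contrapT => /forallNP none.
pose y k x := if modulus u x <= k%:R then modulus u x else 0.
have mu_ := measurable_modulus hu.
have my k : measurable_fun [set: T] (y k).
  by apply: measurable_fun_ifT => //; exact: measurable_fun_ler.
have y0 k x : 0 <= y k x by rewrite /y; case: ifP => // _; exact: modulus_ge0.
have limE x : limn (fun k => (Psi (y k x))%:E) = (Psi (modulus u x))%:E.
  apply: lim_near_cst => //; exists (Num.truncn (modulus u x)).+1 => // k /= hk.
  rewrite /y ifT//; apply: le_trans (ltW (truncnS_gt _)) _.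
  by rewrite ler_nat.
move: mlt; under eq_integral do rewrite -limE.
rewrite monotone_convergence//; last 3 first.
- by move=> k; apply: measurable_funTS; exact: measurable_young_comp.
- by move=> k x _; rewrite lee_fin (young_ge0 hPsi).
- move=> x _ k k' kk'; rewrite lee_fin (young_le hPsi)// /y.
  case: ifPn => [ux|_]; last by case: ifP => // _; exact: modulus_ge0.
  by rewrite ifT// (le_trans ux)// ler_nat.
apply/negP; rewrite -leNgt; apply: lime_le.
  apply: ereal_nondecreasing_is_cvgn => k k' kk'; apply: ge0_le_integral => //.
  - by move=> x _; rewrite lee_fin (young_ge0 hPsi).
  - by apply: measurable_funTS; exact: measurable_young_comp.
  - by apply: measurable_funTS; exact: measurable_young_comp.
  - move=> x _; rewrite lee_fin (young_le hPsi)// /y.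
    case: ifPn => [ux|_]; last by case: ifP => // _; exact: modulus_ge0.
    by rewrite ifT// (le_trans ux)// ler_nat.
by apply: nearW => k; rewrite leNgt; apply/negP; exact: none.
Qed.

(** Let [y] be a truncation of [|u|] for which the integral of [Psi y] over [A]
    still exceeds half of the lower bound [e * M], with [M] the measure of [A].
    Let [v] satisfy [y * v = Phi v + Psi y], and let [J] be the integral of
    [y * v] over [A].  Then [Phi v] has integral at most [J], so the scalar
    [s = min 1 (M / (c * J))] makes the modular of [a * s * v] at most
    [c * Phi a * s * J <= Phi a * M = 1], whereas the integral of
    [|u| * (a * s * v)] is [a * s * J], with [s * J = min J (M / c)]. *)
Lemma dual_extremal (A : set T) (a c e : R) : measurable A ->
  (0 < mu A < +oo)%E -> 0 < a -> ((Phi a)%:E * mu A = 1)%E ->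
  0 < c -> (forall x y, 0 <= x -> 0 <= y -> Phi (x * y) <= c * Phi x * Phi y) ->
  0 < e -> (e%:E * mu A <= \int[mu]_(x in A) (Psi (modulus u x))%:E)%E ->
  exists r : T -> R, [/\ measurable_fun [set: T] r,
    (forall x, 0 <= r x), (forall x, ~ A x \/ modulus u x = 0 -> r x = 0),
    (\int[mu]_x (Phi (r x))%:E <= 1)%E &
    ((a * Num.min (e / 2) c^-1)%:E * mu A <=
       \int[mu]_(x in A) (modulus u x * r x)%:E < +oo)%E].
Proof.
move=> mA /andP[A0 Afin] a0 aA c0 hc e0 eA.
have Ar : mu A \is a fin_num by rewrite ge0_fin_numE.
pose M := fine (mu A); have MA : mu A = M%:E by rewrite fineK.
have M0 : 0 < M by rewrite fine_gt0// A0.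
have aM : Phi a * M = 1 by move: aA; rewrite MA -EFinM => -[].
have [k hk] : exists k : nat, ((e / 2 * M)%:E < \int[mu]_(x in A)
    (Psi (if (modulus u x <= k%:R)%R then modulus u x else 0))%:E)%E.
  apply: truncation_captures => //; apply: lt_le_trans eA.
  by rewrite MA -EFinM lte_fin ltr_pM2r// ltr_pdivrMr// ltr_pMr// ltr1n.
have [p [p0 pmono pE]] := young_equality hPhi.
have mu_ := measurable_modulus hu.
pose y x := if modulus u x <= k%:R then modulus u x else 0.
have my : measurable_fun [set: T] y.
  by apply: measurable_fun_ifT => //; exact: measurable_fun_ler.
have y0 x : 0 <= y x by rewrite /y; case: ifP => // _; exact: modulus_ge0.
have yk x : y x <= k%:R by rewrite /y; case: ifP => // _; exact: ler0n.
have p00 : p 0 = 0.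
  have := pE 0 (lexx _); rewrite mul0r (young0 hPsi) addr0 => /esym.
  by case: hPhi => _ _ _ h _ /h.
pose v x := p (y x).
have mv : measurable_fun [set: T] v.
  apply: measurableT_comp => //; exact: nondecreasing_measurable.
have uvE x : modulus u x * v x = y x * v x.
  by rewrite /v /y; case: ifP => // _; rewrite p00 !mulr0.
have v0 x : 0 <= v x by exact: p0.
pose P := (\int[mu]_(x in A) (Phi (v x))%:E)%E.
pose Q := (\int[mu]_(x in A) (Psi (y x))%:E)%E.
pose I := (\int[mu]_(x in A) (modulus u x * v x)%:E)%E.
have mPv := measurable_young_comp hPhi mv.
have P0 : (0 <= P)%E by apply: integral_ge0 => x _; rewrite lee_fin young_ge0.
have Q0 : (0 <= Q)%E.
  by apply: integral_ge0 => x _; rewrite lee_fin (young_ge0 hPsi).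
have IE : I = (P + Q)%E.
  rewrite /I /P /Q -ge0_integralD//.
  - by apply: eq_integral => x _; rewrite uvE pE// EFinD.
  - by move=> x _; rewrite lee_fin (young_ge0 hPhi).
  - exact: measurable_funTS.
  - by move=> x _; rewrite lee_fin (young_ge0 hPsi).
  - by apply: measurable_funTS; exact: measurable_young_comp.
have muv : measurable_fun A (fun x => (modulus u x * v x)%:E).
  by apply/measurable_funTS/measurable_EFinP/measurable_funM.
have I0 : (0 <= I)%E by rewrite IE adde_ge0.
have Ifin : (I < +oo)%E.
  apply: (@le_lt_trans _ _ (\int[mu]_(x in A) (k%:R * p k%:R)%:E)%E).
    apply: ge0_le_integral => //.
    - by move=> x _; rewrite lee_fin mulr_ge0// modulus_ge0.
    - move=> x _; rewrite lee_fin uvE ler_pM//; exact: pmono.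
  by rewrite integral_cst// MA -EFinM ltry.
pose J := fine I; have JE : I = J%:E by rewrite fineK// ge0_fin_numE.
have JP : (P <= J%:E)%E by rewrite -JE IE leeDl.
have Jlow : e / 2 * M < J.
  by rewrite -lte_fin -JE IE; apply: lt_le_trans hk _; exact: leeDr.
have J0 : 0 < J by apply: lt_trans Jlow; rewrite mulr_gt0// divr_gt0.
pose s := Num.min 1 (M / (c * J)).
have s0 : 0 < s by rewrite lt_min ltr01 divr_gt0// mulr_gt0.
have s1 : s <= 1 by rewrite ge_min lexx.
pose r x := a * (s * v x) * \1_A x.
have rE x : A x -> r x = a * (s * v x).
  by move=> Ax; rewrite /r indicE mem_set// mulr1.
have rE0 x : ~ A x -> r x = 0.
  by move=> Ax; rewrite /r indicE memNset// mulr0.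
exists r; split.
- apply: measurable_funM; last exact/measurable_indicP.
  by do 2! apply: measurable_funM => //.
- move=> x; have [Ax|/rE0 ->//] := pselect (A x).
  by rewrite rE//; do 2! (apply: mulr_ge0 => //; first exact: ltW).
- move=> x [/rE0//|ux0]; rewrite /r /v.
  have -> : y x = 0 by rewrite /y ux0; case: ifP.
  by rewrite p00 !mulr0 mul0r.
- have -> : (\int[mu]_x (Phi (r x))%:E =
      \int[mu]_(x in A) (Phi (a * (s * v x)))%:E)%E.
    rewrite [RHS]integral_mkcond; apply: eq_integral => x _; rewrite patchE.
    case: ifPn => [|/negP]; rewrite inE => Ax; first by rewrite rE.
    by rewrite rE0// (young0 hPhi).
  apply: (@le_trans _ _
    (\int[mu]_(x in A) ((c * Phi a * s)%:E * (Phi (v x))%:E))%E).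
    apply: ge0_le_integral => //.
    - by move=> x _; rewrite lee_fin (young_ge0 hPhi).
    - apply: measurable_funTS; apply: (measurable_young_comp hPhi).
      by do 2! apply: measurable_funM => //.
    - by apply: measurable_funeM; exact: measurable_funTS.
    - move=> x _; rewrite -EFinM lee_fin -(mulrA _ s).
      apply: le_trans (hc _ _ (ltW a0) _) _; first by rewrite mulr_ge0// ltW.
      rewrite ler_wpM2l//; first by rewrite mulr_ge0 ?(young_ge0 hPhi)// ltW.
      by apply: (young_scale_le hPhi) => //; exact: ltW.
  have cas0 : 0 <= c * Phi a * s.
    by rewrite !mulr_ge0 ?(young_ge0 hPhi)// ltW.
  rewrite ge0_integralZl//; last 2 first.
  + exact: measurable_funTS.
  + by move=> x _; rewrite lee_fin (young_ge0 hPhi).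
  apply: (@le_trans _ _ ((c * Phi a * s)%:E * J%:E)%E).
    by rewrite lee_wpmul2l// lee_fin.
  rewrite -EFinM lee_fin.
  have sJ : s * J <= M / c.
    apply: (@le_trans _ _ (M / (c * J) * J)).
      by rewrite ler_wpM2r ?(ltW J0)// ge_min lexx orbT.
    by rewrite le_eqVlt; apply/orP; left; apply/eqP; field; rewrite !gt_eqF.
  apply: (@le_trans _ _ (c * Phi a * (M / c))).
    by rewrite -(mulrA _ s) ler_wpM2l// mulr_ge0 ?(young_ge0 hPhi)// ltW.
  rewrite -{}aM le_eqVlt; apply/orP; left; apply/eqP.
  by field; rewrite gt_eqF.
- have -> : (\int[mu]_(x in A) (modulus u x * r x)%:E = (a * (s * J))%:E)%E.
    rewrite mulrA EFinM -JE /I -ge0_integralZl//; last 2 first.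
    + by move=> x _; rewrite lee_fin mulr_ge0// modulus_ge0.
    + by rewrite lee_fin mulr_ge0// ltW.
    apply: eq_integral => x /[!inE] Ax; rewrite rE// -EFinM; congr EFin.
    ring.
  rewrite ltry andbT MA -EFinM lee_fin -mulrA ler_pM2l//.
  rewrite /s; have [_|_] := leP 1 (M / (c * J)).
    rewrite mul1r; apply: le_trans (ltW Jlow).
    by rewrite ler_pM2r// ge_min lexx.
  have -> : M / (c * J) * J = c^-1 * M by field; rewrite !gt_eqF.
  by rewrite ler_pM2r// ge_min lexx orbT.
Qed.

End ExtremalFunctions.

(** * Compactness and the dual weight *)

Section CompactDual.
Context (R : realType) (d : measure_display) (T : measurableType d).
Variables (mu : {measure set T -> \bar R}) (G : set (set T)).
Hypothesis hG : sigma_algebra [set: T] G.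
Hypothesis hGsub : G `<=` (measurable : set (set T)).
Hypothesis hGfin : sigma_finite [set: g_sigma_algebraType G] mu.
Variable Phi : R -> R.
Hypothesis hPhi : young_function Phi.
Variable u : T -> R[i].
Hypothesis hu : measurable_complex u.
Local Notation Psi := (complementary Phi).
Hypothesis hPsi : young_function Psi.
Local Notation w := (fun x => young_inv Psi (condexp_young mu G Psi u x)).

Lemma level_setE (eps : R) : 0 < eps ->
  [set x | (eps%:E <= w x)%E] =
  [set x | ((Psi eps)%:E <= condexp_young mu G Psi u x)%E].
Proof.
move=> eps0; apply/seteqP; split=> x /=;
  by rewrite (le_young_inv hPsi) ?(ltW eps0)//; exact: condexp_ge0.
Qed.

Lemma measurable_young_modulus (F : R -> R) (f : T -> R[i]) :
  young_function F -> measurable_complex f ->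
  measurable_fun [set: T] (fun x => F (modulus f x)).
Proof.
move=> hF mf; apply: measurableT_comp; first exact: young_measurable.
exact: measurable_modulus.
Qed.

Lemma condexp_youngP (F : R -> R) (f : T -> R[i]) :
  young_function F -> measurable_complex f ->
  is_condexp mu G (fun x => (F (modulus f x))%:E) (condexp_young mu G F f).
Proof.
move=> hF mf.
apply: (@condexpP _ _ _ mu G hG hGsub hGfin (fun x => F (modulus f x))).
  exact: measurable_young_modulus.
by move=> x; exact: young_ge0.
Qed.

Lemma sub_level_set (eps : R) : 0 < eps -> G [set x | (eps%:E <= w x)%E].
Proof.
move=> eps0; rewrite level_setE//; apply/(measurable_subP hG).
have [m _ _] := condexp_youngP hPsi hu.
by rewrite -[X in measurable X]setTI; exact: emeasurable_fun_c_infty.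
Qed.

Hypothesis hT : condexp_mul_bounded mu G Phi u.

(** Multiplying a nonnegative [r] by the phase of the conjugate of [u] turns
    the product with [u] into the nonnegative function [|u| * r], so that no
    cancellation occurs in its conditional expectation.  Where [u = 0] the
    quotient is 0 by convention. *)
Lemma measurable_complex_polar (r : T -> R) : measurable_fun [set: T] r ->
  measurable_complex (fun x => real_complex R (r x / modulus u x) * conjc (u x)).
Proof.
move=> mr; apply: measurable_complexM.
  apply: measurable_complex_real; apply: measurable_funM => //.
  (* the inverse is measurable as a real power *)
  rewrite (_ : (fun x => _) = (fun x => modulus u x `^ (-1))).
    apply: (@measurableT_comp _ _ _ _ _ _ (@powR R ^~ (-1))).
      exact: measurable_powR.
    exact: measurable_modulus.
  by apply/funext => x; rewrite powR_inv1// modulus_ge0.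
split; first by case: hu => + _; congr measurable_fun; apply/funext => x; case: (u x).
rewrite (_ : (fun x => _) = \- (fun x => complex.Im (u x))).
  by apply: measurable_funN; case: hu.
by apply/funext => x /=; case: (u x).
Qed.

Lemma modulus_polar (r : T -> R) x : 0 <= r x -> (modulus u x = 0 -> r x = 0) ->
  modulus (fun x => real_complex R (r x / modulus u x) * conjc (u x)) x = r x.
Proof.
move=> r0 ur.
have cE : Normc.normc (conjc (u x)) = modulus u x.
  by rewrite /modulus; case: (u x) => p q /=; rewrite sqrrN.
rewrite /modulus Normc.normcM normc_real cE ger0_norm ?divr_ge0 ?normc_ge0//.
have [u0|u0] := eqVneq (modulus u x) 0; last by rewrite divfK.
by rewrite u0 mulr0 ur.
Qed.

Lemma mul_polar (r : T -> R) x : (modulus u x = 0 -> r x = 0) ->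
  u x * (real_complex R (r x / modulus u x) * conjc (u x)) =
  real_complex R (modulus u x * r x).
Proof.
move=> ur; have [u0|u0] := eqVneq (modulus u x) 0.
  have -> : u x = 0 by exact: Normc.eq0_normc.
  by rewrite mul0r ur// mulr0.
rewrite mulrCA.
have -> : u x * conjc (u x) = real_complex R (modulus u x ^+ 2).
  rewrite /modulus; case: (u x) => p q /=; rewrite sqr_sqrtr ?addr_ge0 ?sqr_ge0//.
  by apply/eqP; rewrite eq_complex /=; apply/andP; split; apply/eqP; ring.
rewrite -rmorphM /=; congr real_complex_def; rewrite expr2 mulrA divfK//.
by rewrite mulrC.
Qed.

Lemma compact_finitely_many_atoms_dual (eps : R) : 0 < eps ->
  orlicz_compact mu Phi (condexp_mul mu G u) -> delta_prime Phi ->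
  finitely_many_atoms mu G [set x | (eps%:E <= w x)%E].
Proof.
move=> eps0 cpt [c c0 hc]; apply: contrapT => nfin.
have [A [GA AS muA tA]] := not_finitely_many_atoms hG hGsub hGfin
  (sub_level_set eps0) nfin.
have mA n : measurable (A n) := hGsub (GA n).
have Pe0 : 0 < Psi eps by exact: young_gt0.
have [a /all_and2[a0 aA]] := choice (fun n => normalizing_height hPhi (muA n)).
have low n : ((Psi eps)%:E * mu (A n) <=
    \int[mu]_(x in A n) (Psi (modulus u x))%:E)%E.
  have [mE E0 EE] := condexp_youngP hPsi hu.
  rewrite EE// -integral_cst//; apply: ge0_le_integral => //.
  - by move=> x _; rewrite lee_fin ltW.
  - exact/measurable_funTS/(measurable_fun_sub hG hGsub mE).
  - by move=> x /AS; rewrite level_setE.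
have [r rP] := choice (fun n =>
  dual_extremal hPhi hu hPsi (mA n) (muA n) (a0 n) (aA n) c0 hc Pe0 (low n)).
set m := Num.min (Psi eps / 2) c^-1 in rP.
have m0 : 0 < m by rewrite lt_min divr_gt0//= invr_gt0.
pose f n x := real_complex R (r n x / modulus u x) * conjc (u x).
have mf n : measurable_complex (f n).
  by apply: measurable_complex_polar; case: (rP n).
have ur n x : modulus u x = 0 -> r n x = 0.
  by move=> u0; case: (rP n) => _ _ h _ _; apply: h; right.
have rA n x : ~ A n x -> r n x = 0.
  by move=> u0; case: (rP n) => _ _ h _ _; apply: h; left.
have r0 n x : 0 <= r n x by case: (rP n).
have muf n := measurable_complexM hu (mf n).
have ufE n : u \* f n = fun x => real_complex R (modulus u x * r n x).
  by apply/funext => x; exact: mul_polar (ur n x).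
have f1 n : (modular mu Phi setT (f n) 1 <= 1)%E.
  have [_ _ _ + _] := rP n; apply: le_trans.
  rewrite le_eqVlt; apply/orP; left; apply/eqP; apply: eq_integral => x _.
  by rewrite divr1 modulus_polar//; exact: ur.
have fO n : in_orlicz mu Phi (f n).
  by apply: (@modular_in_orlicz _ _ _ _ _ _ 1) => //;
    exact: le_lt_trans (f1 n) (ltry 1).
apply: (@not_orlicz_compact _ _ _ mu Phi hPhi _ f A (m / 4) _ _ mA mf) cpt.
- by rewrite divr_gt0.
- exact: hT.2.1.
- exact: f1.
- move=> k n kn.
  apply: filterS (@condexpC_scale_on _ _ _ mu G hG hGsub hGfin (A n) 0 u _
    (GA n) hu (muf k) (lexx 0) _) => [x E Ax|x Ax].
    by rewrite /condexp_mul E// mul0r.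
  by rewrite ufE rA ?mulr0 ?mul0r//; exact: trivIset_notin Ax.
- move=> n; have /andP[_ Afin] := muA n.
  have [mr _ _ _ /andP[mean fin]] := rP n.
  apply: (@lt_le_trans _ _ ((Phi (2 * a n))%:E * mu (A n))%E).
    apply: (@lt_le_trans _ _ ((2 * Phi (a n))%:E * mu (A n))%E).
      by rewrite EFinM -muleA aA mule1 lte_fin ltr1n.
    by rewrite lee_wpmul2r// lee_fin; apply: young_scale_ge => //; rewrite ler1n.
  apply: modular_ge_of_mean => //.
  + exact: (hT.2.1 _ (fO n)).1.
  + by rewrite mulr_gt0.
  + by rewrite divr_gt0.
  have -> : 2 * (2 * a n) * (m / 4) = a n * m by field.
  apply: le_trans mean _; rewrite /condexp_mul ufE.
  apply: integral_modulus_condexp_ge => //.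
  + by apply: measurable_funM => //; exact: measurable_modulus.
  + by move=> x; rewrite mulr_ge0// modulus_ge0.
Qed.

End CompactDual.

(** * Convergent subsequences *)

Section Subsequence.
Context {R : realType}.

Lemma subsequence_approx (Q : nat -> nat -> Prop) :
  (forall k N, exists2 n, (N <= n)%N & Q k n) ->
  exists s : nat -> nat, {homo s : m n / (m < n)%N >-> (m < n)%N} /\
    forall k, Q k (s k).
Proof.
move=> hQ.
have /choice[p pP] : forall kN : nat * nat, exists n,
    (kN.2 <= n)%N /\ Q kN.1 n.
  by move=> [k N]; have [n Nn Qn] := hQ k N; exists n.
pose s := fix s k := if k is k'.+1 then p (k, (s k').+1) else p (0, 0)%N.
exists s; split; last by case=> [|k]; [exact: (pP (0, 0)%N).2|exact: (pP (_, _)).2].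
apply: homo_ltn => k; first exact: ltn_trans.
exact: (pP (k.+1, (s k).+1)).1.
Qed.

(** The sequence lives in a product of compact intervals, which is compact by
    Tychonoff's theorem, and therefore has a cluster point [l].  The [k]-th
    term of the subsequence is chosen [1 / (k + 1)]-close to [l] in the first
    [k + 1] coordinates. *)
Lemma pointwise_convergent_subsequence (x : nat -> nat -> R) :
  (forall i, exists M, forall n, `|x i n| <= M) ->
  exists (s : nat -> nat) (l : nat -> R),
    {homo s : m n / (m < n)%N >-> (m < n)%N} /\
    forall i, x i (s n) @[n --> \oo] --> l i.
Proof.
move=> /choice[M xM].
pose X n : prod_topology (fun _ : nat => R) := x^~ n.
have cK := @tychonoff nat (fun=> R) (fun i => `[- M i, M i]%classic)
  (fun i => @segment_compact R (- M i) (M i)).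
have [|l [_ cl]] := cK (X n @[n --> \oo]) _.
  exists 0%N => // n _ i /=; rewrite in_itv /= -ler_norml; exact: xM.
have [|s [smono sl]] := @subsequence_approx
    (fun k n => forall i, (i <= k)%N -> `|l i - x i n| < k.+1%:R^-1).
  move=> k N.
  have nl : nbhs (l : prod_topology (fun _ : nat => R))
      [set f | forall i, (i <= k)%N -> `|l i - f i| < k.+1%:R^-1].
    have one i : nbhs (l : prod_topology (fun _ : nat => R))
        [set f | `|l i - f i| < k.+1%:R^-1].
      have e0 : 0 < k.+1%:R^-1 :> R by rewrite invr_gt0.
      have nb : nbhs (l i) [set y : R | `|l i - y| < k.+1%:R^-1].
        exact: (@nbhsx_ballx R R (l i) _ e0).
      exact: (@proj_continuous nat (fun=> R) i l _ nb).
    have FF : Filter (nbhs (l : prod_topology (fun _ : nat => R))).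
      exact: nbhs_filter.
    suff H j : nbhs (l : prod_topology (fun _ : nat => R))
        [set f | forall i, (i <= j)%N -> `|l i - f i| < k.+1%:R^-1] by exact: H.
    elim: j => [|j IH].
      apply: (@filterS _ _ FF _ _ _ (one 0%N)) => f lf i.
      by rewrite leqn0 => /eqP ->.
    apply: (@filterS2 _ _ FF _ _ _ _ IH (one j.+1)) => f lf lfj i.
    by rewrite leq_eqVlt ltnS => /predU1P[->//|]; exact: lf.
  have [|_ [[n Nn <-] /= hn]] := cl [set X n | n in [set n | (N <= n)%N]] _ _ nl.
    by exists N => // n Nn; exists n.
  by exists n.
exists s, l; split => // i; apply/cvgrPdist_lt => e e0.
pose N := (maxn i (Num.truncn e^-1)).
exists N => // n /= Nn.
apply: lt_le_trans (sl n i _) _; first exact: leq_trans (leq_maxl _ _) Nn.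
rewrite invf_ple ?posrE//; apply: le_trans (ltW (truncnS_gt _)) _.
by rewrite ler_nat ltnS; exact: leq_trans (leq_maxr _ _) Nn.
Qed.

End Subsequence.

(** * The conditional Hoelder inequality below a level of the weight *)

Section HolderTail.
Context (R : realType) (d : measure_display) (T : measurableType d).
Variables (mu : {measure set T -> \bar R}) (G : set (set T)).
Hypothesis hG : sigma_algebra [set: T] G.
Hypothesis hGsub : G `<=` (measurable : set (set T)).
Hypothesis hGfin : sigma_finite [set: g_sigma_algebraType G] mu.
Variable Phi : R -> R.
Hypothesis hPhi : young_function Phi.
Variable u : T -> R[i].
Hypothesis hu : measurable_complex u.
Local Notation Psi := (complementary Phi).
Hypothesis hPsi : young_function Psi.
Local Notation w := (fun x => young_inv Psi (condexp_young mu G Psi u x)).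

(** The factor 2 comes from estimating real and imaginary parts separately. *)
Lemma modulus_condexpC_le (f : T -> R[i]) : measurable_complex f ->
  {ae mu, forall x,
    ((modulus (condexpC mu G f) x)%:E <= 2%:E * condexp_abs mu G f x)%E}.
Proof.
move=> mf; have [fr fi] := mf; have mm := measurable_modulus mf.
have dom (g : T -> R) : measurable_fun [set: T] g -> (forall x, 0 <= g x) ->
    (forall x, g x <= modulus f x) -> {ae mu, forall x, [set: T] x ->
    (condexp mu G (EFin \o g) x <= condexp_abs mu G f x)%E}.
  move=> mg g0 gf.
  have := @condexp_le_on _ _ _ mu G hG hGsub hGfin setT g (modulus f)
    (sub_setT hG) mg mm g0 (modulus_ge0 f).
  by apply => x _; exact: gf.
have absRe x := Re_le_normc (f x); have absIm x := Im_le_normc (f x).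
have posle (g : T -> R) : (forall x, `|g x| <= modulus f x) ->
    forall x, g^\+ x <= modulus f x.
  move=> h x; rewrite /funrpos ge_max modulus_ge0 andbT.
  exact: le_trans (ler_norm _) (h x).
have negle (g : T -> R) : (forall x, `|g x| <= modulus f x) ->
    forall x, g^\- x <= modulus f x.
  move=> h x; rewrite /funrneg ge_max modulus_ge0 andbT.
  by apply: le_trans (h x); rewrite -normrN; exact: ler_norm.
have rp := dom _ (measurable_funrpos fr) (funrpos_ge0 _) (posle _ absRe).
have rn := dom _ (measurable_funrneg fr) (funrneg_ge0 _) (negle _ absRe).
have ip := dom _ (measurable_funrpos fi) (funrpos_ge0 _) (posle _ absIm).
have in_ := dom _ (measurable_funrneg fi) (funrneg_ge0 _) (negle _ absIm).
have fineB (a b e : \bar R) : (0 <= a -> 0 <= b -> a <= e -> b <= e ->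
    (`|fine a - fine b|)%:E <= e)%E.
  case: e => [e||]; last 2 first.
  - by move=> *; exact: leey.
  - by case: a => [a||].
  case: a => [a||]//; case: b => [b||]//=.
  rewrite !lee_fin => a0 b0 ae be; rewrite ler_norml; apply/andP; split; lra.
have abs_le (g : T -> R) :
    {ae mu, forall x, [set: T] x ->
      (condexp mu G (EFin \o g^\+%R) x <= condexp_abs mu G f x)%E} ->
    {ae mu, forall x, [set: T] x ->
      (condexp mu G (EFin \o g^\-%R) x <= condexp_abs mu G f x)%E} ->
    {ae mu, forall x, ((`|condexpR mu G g x|)%:E <= condexp_abs mu G f x)%E}.
  move=> gp gn; apply: filterS2 gp gn => x hp hn.
  by apply: fineB; rewrite ?condexp_ge0//; [exact: hp|exact: hn].
apply: filterS2 (abs_le _ rp rn) (abs_le _ ip in_) => x hr hi.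
have -> : (2%:E = 1 + 1 :> \bar R)%E by rewrite -EFinD -(natrD R 1 1).
rewrite ge0_muleDl// mul1e.
apply: le_trans (leeD hr hi); rewrite -EFinD lee_fin.
exact: normc_le_sum.
Qed.

Lemma condexpC_atom (A : set T) (f : T -> R[i]) : atom mu G A ->
  measurable_complex f ->
  exists c, {ae mu, forall x, A x -> condexpC mu G f x = c}.
Proof.
move=> aA [fr fi]; have Afin := atom_lty hG hGsub hGfin aA.
have atomR (g : T -> R) : measurable_fun [set: T] g ->
    exists c, {ae mu, forall x, A x -> condexpR mu G g x = c}.
  move=> mg.
  have [cp hp] := condexp_atom hG hGsub hGfin aA Afin
    (measurable_funrpos mg) (funrpos_ge0 g).
  have [cn hn] := condexp_atom hG hGsub hGfin aA Afin
    (measurable_funrneg mg) (funrneg_ge0 g).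
  exists (fine cp - fine cn); apply: filterS2 hp hn => x p n Ax.
  by rewrite /condexpR p// n.
have [a ha] := atomR _ fr; have [b hb] := atomR _ fi.
exists (a +i* b)%C; apply: filterS2 ha hb => x p n Ax.
by rewrite /condexpC p// n.
Qed.

Variable C : R.
Hypothesis C0 : 0 < C.
Hypothesis holder : forall f g, in_orlicz mu Phi f -> in_orlicz mu Psi g ->
  {ae mu, forall x,
    (condexp_abs mu G (f \* g)%R x <=
       C%:E * (young_inv Phi (condexp_young mu G Phi f x) *
               young_inv Psi (condexp_young mu G Psi g x)))%E}.

(** The inequality cannot be applied to [u], which need not belong to the
    Orlicz space of [Psi].  It applies to the restriction of [u] to a set [B] of
    finite measure in [G] on which [w < eps], because there the integral of
    [Psi u] is at most [Psi eps] times the measure of [B]; by locality nothing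
    changes on [B]. *)
Lemma holder_below_level (f : T -> R[i]) (eps : R) : 0 < eps ->
  in_orlicz mu Phi f ->
  {ae mu, forall x, (w x < eps%:E)%E ->
    (condexp_abs mu G (u \* f)%R x <=
      C%:E * (young_inv Phi (condexp_young mu G Phi f x) * eps%:E))%E}.
Proof.
move=> eps0 fO; have mf := fO.1; have [F FT GF] := sub_exhaustion hG hGfin.
pose D := ~` [set x | (eps%:E <= w x)%E].
have GD : G D.
  rewrite /D -setTD; apply: (sub_setD hG); first exact: sub_setT.
  exact: sub_level_set.
have [mE _ EE] := condexp_youngP hG hGsub hGfin hPsi hu.
suff main j : {ae mu, forall x, (F j `&` D) x ->
    (condexp_abs mu G (u \* f)%R x <=
      C%:E * (young_inv Phi (condexp_young mu G Phi f x) * eps%:E))%E}.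
  apply: filterS (ae_foralln main) => x h wx.
  have [j _ Fj] : (\bigcup_n F n) x by rewrite FT.
  by apply: (h j); split => //=; apply/negP; rewrite -ltNge.
have GB : G (F j `&` D) by apply: (sub_setI hG) => //; exact: (GF j).1.
have mB := hGsub GB; set B := F j `&` D in GB mB *.
have Bfin : (mu B < +oo)%E.
  apply: le_lt_trans (GF j).2; apply: le_measure; rewrite ?inE//.
    exact: hGsub (GF j).1.
  by move=> x [].
pose g x := real_complex R (\1_B x) * u x.
have mg : measurable_complex g.
  apply: measurable_complexM => //; apply: measurable_complex_real.
  exact/measurable_indicP.
have gB x : B x -> g x = u x.
  by move=> Bx; rewrite /g indicE mem_set// mul1r.
have gB0 x : ~ B x -> g x = 0.
  by move=> Bx; rewrite /g indicE memNset// mul0r.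
have gO : in_orlicz mu Psi g.
  apply: (@modular_in_orlicz _ _ _ _ _ _ 1) => //.
  apply: (@le_lt_trans _ _ ((Psi eps)%:E * mu B)%E); last first.
    apply: lte_mul_pinfty; [|by []|exact: Bfin].
    by rewrite lee_fin (young_ge0 hPsi).
  rewrite -integral_cst//.
  have -> : modular mu Psi setT g 1 = (\int[mu]_(x in B) (Psi (modulus u x))%:E)%E.
    rewrite [RHS]integral_mkcond; apply: eq_integral => x _; rewrite patchE divr1.
    case: ifPn => [|/negP]; rewrite inE => Bx; first by rewrite /modulus gB.
    by rewrite /modulus gB0// Normc.normc0 (young0 hPsi).
  rewrite EE//; apply: ge0_le_integral => //.
  - by move=> x _; exact: condexp_ge0.
  - exact/measurable_funTS/(measurable_fun_sub hG hGsub mE).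
  - move=> x [_ Dx]; move: Dx; rewrite /D level_setE//= => /negP.
    by rewrite -ltNge => /ltW.
have E1 := @condexp_eq_on _ _ _ mu G hG hGsub hGfin B (modulus (f \* g))
  (modulus (u \* f)) GB (measurable_modulus (measurable_complexM mf mg))
  (measurable_modulus (measurable_complexM hu mf))
  (modulus_ge0 _) (modulus_ge0 _).
have E2 := @condexp_eq_on _ _ _ mu G hG hGsub hGfin B
  (fun x => Psi (modulus u x)) (fun x => Psi (modulus g x)) GB
  (measurable_young_modulus hPsi hu) (measurable_young_modulus hPsi mg)
  (fun x => young_ge0 hPsi _) (fun x => young_ge0 hPsi _).
apply: filterS3 (E1 _) (E2 _) (holder fO gO) => [x e1 e2 h Bx|x Bx|x Bx].
- rewrite /condexp_abs in h *; rewrite [X in (X <= _)%E](e1 Bx).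
  apply: le_trans h _; rewrite lee_wpmul2l//; first by rewrite lee_fin ltW.
  rewrite /condexp_young [X in young_inv Psi X](e2 Bx).
  apply: lee_wpmul2l; first by apply: young_inv_ge0 => //; exact: condexp_ge0.
  have [_ Dx] := Bx; move: Dx; rewrite /D /= => /negP.
  by rewrite -ltNge => /ltW.
- by rewrite /modulus /= gB// mulrC.
- by rewrite /modulus gB.
Qed.

Lemma young_below_level (f : T -> R[i]) (eps : R) : 0 < eps ->
  in_orlicz mu Phi f ->
  {ae mu, forall x, (w x < eps%:E)%E ->
    ((Phi (modulus (condexp_mul mu G u f) x / (2 * C * eps)))%:E <=
      condexp_young mu G Phi f x)%E}.
Proof.
move=> eps0 fO; have mf := fO.1.
apply: filterS2 (holder_below_level eps0 fO)
  (modulus_condexpC_le (measurable_complexM hu mf)) => x h1 h2 wx.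
have {h1} := h1 wx.
set t := condexp_young mu G Phi f x.
have t0 : (0 <= t)%E by exact: condexp_ge0.
move=> h1; rewrite -(le_young_inv hPhi)//; last first.
  by rewrite divr_ge0 ?modulus_ge0// ltW// !mulr_gt0.
have {h2}h : ((modulus (condexpC mu G (u \* f)) x)%:E <=
    (2 * C * eps)%:E * young_inv Phi t)%E.
  apply: le_trans h2 _; rewrite !EFinM -!muleA lee_wpmul2l//.
  by apply: le_trans h1 _; rewrite [(_ * eps%:E)%E]muleC.
move: h; have e0 : 0 < 2 * C * eps by rewrite !mulr_gt0.
case: (young_inv Phi t) (young_inv_ge0 hPhi t0) => [r||]//.
  move=> _; rewrite -EFinM !lee_fin => h.
  by rewrite ler_pdivrMr// mulrC.
by move=> _ _; exact: leey.
Qed.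

End HolderTail.

(** * Passing to the limit *)

Section LimitLemmas.
Context {R : realType} d {T : measurableType d}.
Variable mu : {measure set T -> \bar R}.
Variable Phi : R -> R.
Hypothesis hPhi : young_function Phi.

Lemma modular_fatou (D : set T) (f : nat -> T -> R[i]) (h : T -> R[i]) k :
  measurable D -> (forall n, measurable_complex (f n)) ->
  measurable_complex h ->
  {ae mu, forall x,
    complex.Re (f n x) @[n --> \oo] --> complex.Re (h x) /\
    complex.Im (f n x) @[n --> \oo] --> complex.Im (h x)} ->
  (forall n, modular mu Phi D (f n) k <= 1)%E -> (modular mu Phi D h k <= 1)%E.
Proof.
move=> mD mf mh fh f1.
have mPf n := measurable_funTS (D := D)
  (measurable_modular_integrand hPhi k (mf n)).
have mPh := measurable_funTS (D := D) (measurable_modular_integrand hPhi k mh).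
have P0 (g : T -> R[i]) x : (0 <= (Phi (modulus g x / k))%:E)%E.
  by rewrite lee_fin (young_ge0 hPhi).
have := fatou mu mD mPf (fun n x _ => P0 (f n) x).
set I := (X in (_ <= X)%E -> _) => If.
have I1 : (I <= 1)%E.
  rewrite /I limn_einf_lim; apply: lime_le.
    exact: is_cvg_einfs.
  apply: nearW => n; apply: le_trans (f1 n); apply: ereal_inf_lbound.
  by exists n => //=.
apply: le_trans (le_trans If I1); apply: ae_ge0_le_integral => //.
- move=> x _; rewrite limn_einf_lim; apply: lime_ge; first exact: is_cvg_einfs.
  by apply: nearW => n; apply: le_ereal_inf_tmp => _ [m _ <-].
- rewrite (_ : (fun x => _) =
      (fun x => (- limn_esup (fun n => - (Phi (modulus (f n) x / k))%:E))%E)).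
    apply: measurableT_comp => //; apply: measurable_fun_limn_esup => n.
    exact: measurableT_comp.
  apply/funext => x; rewrite -limn_einfN; congr limn_einf.
  by apply/funext => n /=; rewrite opprK.
apply: filterS fh => x [re im] _.
have cv :
    (Phi (modulus (f n) x / k))%:E @[n --> \oo] --> (Phi (modulus h x / k))%:E.
  apply: cvg_EFin; first exact: nearW.
  apply: (@cvg_comp _ _ _ (fun n => modulus (f n) x / k) Phi); last first.
    exact: young_continuous.
  apply: cvgMl; rewrite modulusE.
  under eq_fun do rewrite modulusE.
  apply: (@cvg_comp _ _ _
    (fun n => complex.Re (f n x) ^+ 2 + complex.Im (f n x) ^+ 2) Num.sqrt);
    last exact: sqrt_continuous.
  by apply: cvgD; apply: cvgM.
rewrite is_cvg_limn_einfE; last by apply/cvg_ex; eexists; exact: cv.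
by have /cvg_lim <- := cv.
Qed.

End LimitLemmas.

(** * Finite unions of atoms *)

Section AtomicCover.
Context (R : realType) (d : measure_display) (T : measurableType d).
Variables (mu : {measure set T -> \bar R}) (G : set (set T)).
Hypothesis hG : sigma_algebra [set: T] G.
Hypothesis hGsub : G `<=` (measurable : set (set T)).
Hypothesis hGfin : sigma_finite [set: g_sigma_algebraType G] mu.
Variable Phi : R -> R.
Hypothesis hPhi : young_function Phi.
Variable u : T -> R[i].
Hypothesis hu : measurable_complex u.
Local Notation Psi := (complementary Phi).
Hypothesis hPsi : young_function Psi.
Local Notation w := (fun x => young_inv Psi (condexp_young mu G Psi u x)).

(** A function equal to [c] on an atom has modular at least [Phi (|c| / K)]
    times the measure of the atom, which is positive. *)
Lemma atom_coefficient_bound (A : set T) (K : R) : atom mu G A -> 0 < K ->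
  exists B, forall f c, measurable_complex f ->
    (modular mu Phi setT f K <= 1)%E -> {ae mu, forall x, A x -> f x = c} ->
    Normc.normc c <= B.
Proof.
move=> aA K0; have Afin := atom_lty hG hGsub hGfin aA.
have [GA A0 _] := aA; have mA := hGsub GA.
have [|a [a0 aA1]] := @normalizing_height _ _ _ mu Phi hPhi A; first by rewrite A0.
exists (a * K) => f c mf f1 fc; rewrite -ler_pdivrMr//.
have c0 : 0 <= Normc.normc c / K by rewrite divr_ge0 ?normc_ge0// ltW.
rewrite -(young_le_iff hPhi)// ?(ltW a0)// -lee_fin.
rewrite -(@lee_pmul2r _ (mu A))//; last by rewrite ge0_fin_numE.
rewrite aA1; apply: le_trans f1; rewrite -integral_cst//.
apply: (@le_trans _ _ (modular mu Phi A f K)); last first.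
  apply: ge0_subset_integral => //.
  - exact: measurable_modular_integrand.
  - by move=> x _; rewrite lee_fin (young_ge0 hPhi).
apply: ae_ge0_le_integral => //.
- by move=> x _; rewrite lee_fin (young_ge0 hPhi).
- by move=> x _; rewrite lee_fin (young_ge0 hPhi).
- exact/measurable_funTS/measurable_modular_integrand.
- by apply: filterS fc => x + Ax; rewrite /modulus => ->.
Qed.

(** The atoms are reindexed by natural numbers, with empty sets beyond the
    [n]-th, in order to enumerate the atoms of all level sets at once. *)
Lemma finitely_many_atoms_nat (S : set T) : finitely_many_atoms mu G S ->
  exists (n : nat) (F : nat -> set T),
    (forall i, (i < n)%N -> atom mu G (F i)) /\
    {ae mu, forall x, S x -> exists2 i, (i < n)%N & F i x}.
Proof.
move=> [n [F [aF _ nF]]].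
exists n, (fun i => if insub i is Some j then F j else set0); split.
  by move=> i ltin; rewrite insubT.
apply: negligibleS nF => x /= /not_implyP[Sx nx]; left; split => // -[i _ Fix].
by apply: nx; exists i => //; rewrite valK.
Qed.

Lemma finite_eventually (n : nat) (P : nat -> nat -> Prop) :
  (forall i, (i < n)%N -> \forall m \near \oo, P i m) ->
  \forall m \near \oo, forall i, (i < n)%N -> P i m.
Proof.
elim: n => [|n IH] h; first by apply: nearW.
have h1 := IH (fun i ltin => h i (ltn_trans ltin (ltnSn n))).
apply: filterS2 h1 (h n (ltnSn n)) => m Pm Pn i.
by rewrite ltnS leq_eqVlt => /predU1P[->//|]; exact: Pm.
Qed.

Lemma finite_measure_cover (S : set T) (n : nat) (F : nat -> set T) :
  measurable S -> (forall i, (i < n)%N -> measurable (F i)) ->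
  (forall i, (i < n)%N -> mu (F i) < +oo)%E ->
  {ae mu, forall x, S x -> exists2 i, (i < n)%N & F i x} ->
  (mu S < +oo)%E.
Proof.
move=> mS mF Ffin cov.
pose U := \big[setU/set0]_(i < n) F i.
have mU : measurable U by apply: bigsetU_measurable => i _; exact: mF.
have UP x : U x <-> exists2 i, (i < n)%N & F i x.
  rewrite /U -(bigcup_mkord n F); split=> [[i /= ltin Fix]|[i ltin Fix]];
  by exists i.
have SU : mu (S `\` U) = 0%E.
  apply/negligibleP; first exact: measurableD.
  apply: negligibleS cov => x [Sx nU] /= h; apply: nU.
  by apply/UP; exact: h.
rewrite -(setUIDK S U) (le_lt_trans (measureU2 mu _ _))//.
  exact: measurableI.
  exact: measurableD.
rewrite [X in (_ + X)%E]SU adde0.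
apply: (@le_lt_trans _ _ (mu U)).
  by apply: le_measure; rewrite ?inE//; exact: measurableI.
apply: le_lt_trans (Boole_inequality mu mF) _.
by apply: lte_sum_pinfty => i _; exact: Ffin.
Qed.

End AtomicCover.

(** * The operator below a level of the weight *)

Section BelowLevel.
Context (R : realType) (d : measure_display) (T : measurableType d).
Variables (mu : {measure set T -> \bar R}) (G : set (set T)).
Hypothesis hG : sigma_algebra [set: T] G.
Hypothesis hGsub : G `<=` (measurable : set (set T)).
Hypothesis hGfin : sigma_finite [set: g_sigma_algebraType G] mu.
Variable Phi : R -> R.
Hypothesis hPhi : young_function Phi.
Variable u : T -> R[i].
Hypothesis hu : measurable_complex u.
Local Notation Psi := (complementary Phi).
Hypothesis hPsi : young_function Psi.
Local Notation w := (fun x => young_inv Psi (condexp_young mu G Psi u x)).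
Hypothesis hT : condexp_mul_bounded mu G Phi u.
Local Notation A := (condexp_mul mu G u).

(** With [g = f / K], the pointwise bound says that [Phi] of the scaled image is
    at most the conditional expectation of [Phi g], whose integral is at most
    1.  Where [w] vanishes the bound holds at all levels: [Phi (k * z)] is at
    most one finite value for every [k], which forces [z = 0]. *)
Lemma modular_below_level : holder_conditional mu G Phi ->
  exists2 C : R, 0 < C & forall (f : T -> R[i]) (K : R),
    0 < K -> measurable_complex f -> (modular mu Phi setT f K <= 1)%E ->
    (forall eps, 0 < eps ->
      (modular mu Phi [set x | (w x < eps%:E)%E] (A f) (C * K * eps) <= 1)%E) /\
    {ae mu, forall x, (w x <= 0)%E -> A f x = 0}.
Proof.
move=> [C C0 holder]; exists (2 * C); first by rewrite mulr_gt0.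
move=> f K K0 mf fK.
pose g x := real_complex R K^-1 * f x.
have mg : measurable_complex g.
  by apply: measurable_complexM => //; apply: measurable_complex_real.
have gE x : modulus g x = modulus f x / K.
  by rewrite /modulus Normc.normcM normc_real gtr0_norm ?invr_gt0// mulrC.
have g1 : (\int[mu]_x (Phi (modulus g x))%:E <= 1)%E.
  by under eq_integral do rewrite gE.
have gO : in_orlicz mu Phi g.
  apply: (@modular_in_orlicz _ _ _ _ _ _ 1) => //.
  rewrite /modular; under eq_integral do rewrite divr1.
  exact: le_lt_trans g1 (ltry 1).
have AfE : {ae mu, forall x, modulus (A g) x = modulus (A f) x / K}.
  apply: filterS (@condexpC_scale_on _ _ _ mu G hG hGsub hGfin setT K^-1
    (u \* f) (u \* g) (sub_setT hG) (measurable_complexM hu mf)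
    (measurable_complexM hu mg) _ _) => [x /(_ I) E||x _].
  - rewrite /modulus /condexp_mul E Normc.normcM normc_real.
    by rewrite gtr0_norm ?invr_gt0// mulrC.
  - by rewrite invr_ge0 ltW.
  - by rewrite /= /g mulrCA.
have [mE E0 EE] := condexp_youngP hG hGsub hGfin hPhi mg.
have mE' := measurable_fun_sub hG hGsub mE.
have E1 : (\int[mu]_x condexp_young mu G Phi g x <= 1)%E.
  by rewrite -EE//; exact: sub_setT.
have fO : in_orlicz mu Phi f.
  by apply: (@modular_in_orlicz _ _ _ _ _ _ K) => //; exact: le_lt_trans fK (ltry 1).
have mAf : measurable_complex (A f) by exact: (hT.2.1 _ fO).1.
have below eps : 0 < eps -> {ae mu, forall x, (w x < eps%:E)%E ->
    ((Phi (modulus (A f) x / (2 * C * K * eps)))%:E <=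
      condexp_young mu G Phi g x)%E}.
  move=> eps0.
  apply: filterS2 (young_below_level hG hGsub hGfin hPhi hu hPsi C0 holder eps0 gO)
    AfE => x h E wx.
  rewrite [X in Phi X](_ : _ = modulus (A g) x / (2 * C * eps)); first exact: h.
  by rewrite E; field; rewrite !gt_eqF.
split.
  move=> eps eps0; apply: le_trans E1.
  have mD : measurable [set x | (w x < eps%:E)%E].
    rewrite [X in measurable X](_ : _ = ~` [set x | (eps%:E <= w x)%E]).
      apply: measurableC; apply: hGsub.
      exact: (sub_level_set hG hGsub hGfin hu hPsi).
    by apply/seteqP; split => x /=; rewrite ltNge => /negP.
  apply: (@le_trans _ _ (\int[mu]_(x in [set x | (w x < eps%:E)%E])
      condexp_young mu G Phi g x)%E); last first.
    by apply: ge0_subset_integral => //; exact: measurable_funTS.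
  apply: ae_ge0_le_integral => //.
  - by move=> x _; rewrite lee_fin (young_ge0 hPhi).
  - exact/measurable_funTS/measurable_modular_integrand.
  - exact: measurable_funTS.
  - exact: below.
have Efin : {ae mu, forall x, (condexp_young mu G Phi g x < +oo)%E}.
  have intE : mu.-integrable setT (condexp_young mu G Phi g).
    apply/integrableP; split => //.
    under eq_integral do rewrite gee0_abs//.
    exact: le_lt_trans E1 (ltry 1).
  apply: filterS (integrable_ae measurableT intE) => x /(_ I).
  by rewrite ge0_fin_numE.
have inv0 k : 0 < k.+1%:R^-1 :> R by rewrite invr_gt0.
apply: filterS2 (ae_foralln (fun k => below _ (inv0 k))) Efin => x h fin wx.
apply: Normc.eq0_normc; apply/eqP; rewrite -/(modulus (A f) x).
apply: contraTT isT => n0.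
have m0 : 0 < modulus (A f) x by rewrite lt_neqAle modulus_ge0 eq_sym n0.
pose z := modulus (A f) x / (2 * C * K).
have z0 : 0 < z by rewrite divr_gt0// !mulr_gt0.
have Pz : 0 < Phi z by exact: young_gt0.
pose r := fine (condexp_young mu G Phi g x).
have rE : condexp_young mu G Phi g x = r%:E by rewrite fineK// ge0_fin_numE.
pose k := Num.truncn (r / Phi z).
have := h k _; rewrite rE lee_fin => /(_ _)/wrap[|].
  by apply: le_lt_trans wx _; rewrite lte_fin.
have -> : modulus (A f) x / (2 * C * K * k.+1%:R^-1) = k.+1%:R * z.
  by rewrite /z; field; rewrite !gt_eqF.
move=> hk; have := le_trans (@young_scale_ge _ _ hPhi k.+1%:R z _) hk.
rewrite ler1n => /(_ isT); rewrite -ler_pdivlMr// => /le_lt_trans.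
by move=> /(_ _ (truncnS_gt _)); rewrite ltxx.
Qed.

End BelowLevel.

(** * Compactness from finitely many atoms *)

Section Sufficiency.
Context (R : realType) (d : measure_display) (T : measurableType d).
Variables (mu : {measure set T -> \bar R}) (G : set (set T)).
Hypothesis hG : sigma_algebra [set: T] G.
Hypothesis hGsub : G `<=` (measurable : set (set T)).
Hypothesis hGfin : sigma_finite [set: g_sigma_algebraType G] mu.
Variable Phi : R -> R.
Hypothesis hPhi : young_function Phi.
Variable u : T -> R[i].
Hypothesis hu : measurable_complex u.
Local Notation Psi := (complementary Phi).
Hypothesis hPsi : young_function Psi.
Local Notation w := (fun x => young_inv Psi (condexp_young mu G Psi u x)).
Hypothesis hT : condexp_mul_bounded mu G Phi u.
Local Notation A := (condexp_mul mu G u).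

Lemma bounded_modular (f : nat -> T -> R[i]) :
  (forall n, in_orlicz mu Phi (f n)) ->
  (exists M, forall n, orlicz_norm mu Phi (f n) <= M) ->
  exists2 K, 0 < K & forall n, (modular mu Phi setT (f n) K <= 1)%E.
Proof.
move=> fO [M fM]; exists (`|M| + 1); first by rewrite ltr_wpDl.
move=> n; apply: (orlicz_norm_lt hPhi (fO n)).
by apply: le_lt_trans (fM n) _; rewrite ltr_pwDr// ler_norm.
Qed.

Lemma limn_esup_fine (v : nat -> R) (l : R) : v n @[n --> \oo] --> l ->
  fine (limn_esup (fun n => (v n)%:E)) = l.
Proof.
move=> vl; have cv : (v n)%:E @[n --> \oo] --> l%:E.
  by apply: cvg_EFin => //; exact: nearW.
rewrite is_cvg_limn_esupE; last by apply/cvg_ex; exists l%:E.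
by have /cvg_lim -> := cv.
Qed.

(** [N k] and [D k] are the sets where [w] is at least, respectively below,
    [e k = 1 / (k + 1)], and [F k i] for [i < n0 k] are the atoms that make up
    [N k].  Along the subsequence the constant values [c] of the images on all
    these atoms converge, to [L]. *)
Lemma compact_of_finitely_many_atoms : holder_conditional mu G Phi ->
  (forall eps : R, 0 < eps ->
    finitely_many_atoms mu G [set x | (eps%:E <= w x)%E]) ->
  orlicz_compact mu Phi A.
Proof.
move=> holder fin f fO fM.
have [C C0 tail] := modular_below_level hG hGsub hGfin hPhi hu hPsi hT holder.
have [K K0 fK] := bounded_modular fO fM.
have mf n := (fO n).1.
have AO n := hT.2.1 _ (fO n).
have mA n := (AO n).1.
have [K' K'0 AK'] : exists2 K, 0 < K &
    forall n, (modular mu Phi setT (A (f n)) K <= 1)%E.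
  apply: bounded_modular => //.
  have [M1 hM1] := hT.2.2; have [M hM] := fM.
  exists (`|M1| * M) => n; apply: le_trans (hM1 _ (fO n)) _.
  apply: (@le_trans _ _ (`|M1| * orlicz_norm mu Phi (f n))).
    by rewrite ler_wpM2r ?orlicz_norm_ge0// ler_norm.
  by rewrite ler_wpM2l.
pose e k : R := k.+1%:R^-1.
have e0 k : 0 < e k by rewrite invr_gt0.
pose N k := [set x | ((e k)%:E <= w x)%E].
pose D k := [set x | (w x < (e k)%:E)%E].
have mN k : measurable (N k).
  by apply: hGsub; exact: (sub_level_set hG hGsub hGfin hu hPsi).
have DE k : D k = ~` N k.
  by apply/seteqP; split => x; rewrite /D /N /= ltNge => /negP.
have mD k : measurable (D k) by rewrite DE; exact: measurableC.
have [n0 /choice[F /all_and2[aF covF]]] :=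
  choice (fun k => finitely_many_atoms_nat (fin _ (e0 k))).
have coef (p : nat * nat) : exists B, forall m, exists c, Normc.normc c <= B /\
    ((p.2 < n0 p.1)%N -> {ae mu, forall x, F p.1 p.2 x -> A (f m) x = c}).
  have [lt|ge] := boolP (p.2 < n0 p.1)%N; last first.
    by exists 0 => m; exists 0; split => //; rewrite Normc.normc0.
  have [B hB] := atom_coefficient_bound hG hGsub hGfin hPhi (aF _ _ lt) K'0.
  exists B => m.
  have [c hc] := condexpC_atom hG hGsub hGfin (aF _ _ lt)
    (measurable_complexM hu (mf m)).
  by exists c; split => //; exact: (hB _ _ (mA m) (AK' m) hc).
have [B hB] := choice coef.
have [c cP] := choice (fun q : (nat * nat) * nat => hB q.1 q.2).
(* real and imaginary parts of all the constants, as one countable family *)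
pose X (q : nat) n := match unpickle q : option (bool * (nat * nat)) with
  | Some (b, p) =>
      if (b : bool) then complex.Re (c (p, n)) else complex.Im (c (p, n))
  | None => 0 end.
have [|s [l [smono lim]]] := @pointwise_convergent_subsequence R X.
  move=> q; rewrite /X; case: unpickle => [[b p]|]; last first.
    by exists 0 => n; rewrite normr0.
  exists (B p) => n; have [cB _] := cP (p, n).
  by apply: le_trans cB; case: b; [exact: Re_le_normc|exact: Im_le_normc].
have limRe (p : nat * nat) :
    complex.Re (c (p, s n)) @[n --> \oo] --> l (pickle (true, p)).
  by have := lim (pickle (true, p)); rewrite /X pickleK.
have limIm (p : nat * nat) :
    complex.Im (c (p, s n)) @[n --> \oo] --> l (pickle (false, p)).
  by have := lim (pickle (false, p)); rewrite /X pickleK.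
pose L (p : nat * nat) := (l (pickle (true, p)) +i* l (pickle (false, p)))%C.
(* upper limits give a function measurable everywhere, equal to the limit
   almost everywhere *)
pose h x := (fine (limn_esup (fun n => (complex.Re (A (f (s n)) x))%:E)) +i*
  fine (limn_esup (fun n => (complex.Im (A (f (s n)) x))%:E)))%C.
have mh : measurable_complex h.
  by split; apply: measurableT_comp => //; apply: measurable_fun_limn_esup => n;
    apply/measurable_EFinP; case: (mA (s n)).
have hE x (z : R[i]) :
    complex.Re (A (f (s n)) x) @[n --> \oo] --> complex.Re z ->
    complex.Im (A (f (s n)) x) @[n --> \oo] --> complex.Im z -> h x = z.
  move=> /(@limn_esup_fine (fun n => complex.Re (A (f (s n)) x))) re.
  move=> /(@limn_esup_fine (fun n => complex.Im (A (f (s n)) x))) im.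
  have -> : z = (complex.Re z +i* complex.Im z)%C by case: (z).
  by rewrite -re -im.
have onF : {ae mu, forall x, forall k i m, (i < n0 k)%N -> F k i x ->
    A (f m) x = c ((k, i), m)}.
  apply: ae_foralln => k; apply: ae_foralln => i; apply: ae_foralln => m.
  have [lt|ge] := boolP (i < n0 k)%N; last by apply: aeW => x.
  have [_ /(_ lt) hc] := cP ((k, i), m).
  by apply: filterS hc => x hx _.
have good : {ae mu, forall x,
    (complex.Re (A (f (s n)) x) @[n --> \oo] --> complex.Re (h x) /\
     complex.Im (A (f (s n)) x) @[n --> \oo] --> complex.Im (h x)) /\
    forall k i, (i < n0 k)%N -> F k i x -> h x = L (k, i)}.
  have zero := ae_foralln (fun m => (tail _ _ K0 (mf m) (fK m)).2).
  apply: filterS3 onF zero (ae_foralln covF) => x hF hz hcov.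
  have onFx k i : (i < n0 k)%N -> F k i x ->
      complex.Re (A (f (s n)) x) @[n --> \oo] --> complex.Re (L (k, i)) /\
      complex.Im (A (f (s n)) x) @[n --> \oo] --> complex.Im (L (k, i)).
    move=> lt Fx; split.
      by under eq_fun do rewrite (hF k i _ lt Fx); exact: limRe.
    by under eq_fun do rewrite (hF k i _ lt Fx); exact: limIm.
  have hL k i : (i < n0 k)%N -> F k i x -> h x = L (k, i).
    by move=> lt Fx; have [re im] := onFx _ _ lt Fx; exact: hE.
  split => //.
  have [[k Nk]|nN] := pselect (exists k, N k x).
    have [i lt Fx] := hcov k Nk.
    by rewrite (hL _ _ lt Fx); exact: onFx.
  have wx : (w x <= 0)%E.
    apply: contrapT => /negP; rewrite -ltNge => wpos; apply: nN.
    rewrite /N /=; case: (w x) wpos => [r||]//; last by exists 0%N; rewrite leey.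
    rewrite lte_fin => r0; exists (Num.truncn r^-1); rewrite lee_fin.
    by rewrite /e invf_ple ?posrE//; exact/ltW/truncnS_gt.
  have A0 n : A (f (s n)) x = 0 by exact: hz.
  have h0 : h x = 0.
    by apply: hE; under eq_fun do rewrite A0; exact: cvg_cst.
  by rewrite h0; split; under eq_fun do rewrite A0; exact: cvg_cst.
have goodcvg : {ae mu, forall x,
    complex.Re (A (f (s n)) x) @[n --> \oo] --> complex.Re (h x) /\
    complex.Im (A (f (s n)) x) @[n --> \oo] --> complex.Im (h x)}.
  by apply: filterS good => x [].
have hO : in_orlicz mu Phi h.
  apply: (@modular_in_orlicz _ _ _ _ _ _ K') => //.
  apply: le_lt_trans (ltry 1).
  exact: (@modular_fatou _ _ _ mu Phi hPhi setT (fun n => A (f (s n))) h K'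
    measurableT (fun n => mA (s n)) mh goodcvg (fun n => AK' (s n))).
exists s, h; split => //.
apply/cvgrPdist_le => delta delta0.
pose k := Num.truncn (4 * (C * K) / delta).
pose kap := C * K * e k.
have CK0 : 0 < C * K by rewrite mulr_gt0.
have kap0 : 0 < kap by rewrite mulr_gt0.
have kapd : 4 * kap <= delta.
  rewrite /kap [leLHS]mulrA ler_pdivrMr// [leRHS]mulrC -ler_pdivrMr//.
  exact/ltW/truncnS_gt.
(* below the level the images and their limit have modular at most 1 at scale
   kap; doubling the scale twice leaves at most one half for the difference *)
have tailD n : (modular mu Phi (D k) (A (f (s n)) \- h)%R (2 * (kap + kap)) <=
    (2^-1)%:E)%E.
  have m0 : measurable_complex (fun _ : T => 0 : R[i]).
    by split; exact: measurable_cst.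
  have f0E (g : T -> R[i]) : (g \- (fun=> 0))%R = g.
    by apply/funext => x /=; rewrite subr0.
  have tf m : (modular mu Phi (D k) (A (f (s m))) kap <= 1)%E.
    by have [+ _] := tail _ _ K0 (mf (s m)) (fK (s m)); exact.
  have th := @modular_fatou _ _ _ mu Phi hPhi (D k) (fun n => A (f (s n))) h kap
    (mD k) (fun n => mA (s n)) mh goodcvg tf.
  have := modular_triangle mu hPhi (mD k) (mA (s n)) mh m0 kap0.
  rewrite !f0E => tri.
  have tri1 : (modular mu Phi (D k) (A (f (s n)) \- h)%R (kap + kap) <= 1)%E.
    apply: le_trans tri _; apply: (@le_trans _ _ ((2^-1)%:E * (1 + 1))%E).
      by rewrite lee_pmul2l ?lte_fin// leeD.
    by rewrite -EFinD -EFinM lee_fin -(natrD R 1 1) mulVf.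
  have := modular_scale mu hPhi (kap + kap) (mD k)
    (measurable_complexB (mA (s n)) mh) (ler1n R 2).
  move=> /le_trans /(_ tri1) sc.
  by rewrite -(@lee_pmul2l _ 2%:E)// -EFinM divff// ?pnatr_eq0.
have Nfin : (mu (N k) < +oo)%E.
  apply: (finite_measure_cover (mN k) _ _ (covF k)) => i lt.
    by have [/hGsub] := aF _ _ lt.
  exact: (atom_lty hG hGsub hGfin (aF _ _ lt)).
pose q := fine (mu (N k)); have qE : mu (N k) = q%:E.
  by rewrite fineK// ge0_fin_numE.
have q0 : 0 <= q by exact: fine_ge0.
(* a constant function of height a has modular at most one half on N k *)
have [a a0 Pa] := young_surjective hPhi
  (ltW (divr_gt0 ltr01 (mulr_gt0 (ltr0Sn R 1) (ltr_wpDl q0 ltr01)))).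
have apos : 0 < a.
  rewrite lt_neqAle a0 andbT; apply/eqP => a00.
  move: Pa; rewrite -a00 (young0 hPhi) => /esym/eqP.
  by rewrite gt_eqF// divr_gt0// mulr_gt0// ltr_wpDl.
pose eta := a * (2 * (kap + kap)).
have eta0 : 0 < eta by rewrite !mulr_gt0// addr_gt0.
have unif : \forall n \near \oo, forall i, (i < n0 k)%N ->
    Normc.normc (c ((k, i), s n) - L (k, i)) <= eta.
  apply: finite_eventually => i lt.
  have eta20 : 0 < eta / 2 by rewrite divr_gt0.
  have /cvgrPdist_le /(_ _ eta20) nre := limRe (k, i).
  have /cvgrPdist_le /(_ _ eta20) nim := limIm (k, i).
  apply: filterS2 nre nim => n re im.
  apply: le_trans (normc_le_sum _) _; rewrite [leRHS]splitr lerD//.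
    by rewrite distrC in re; apply: le_trans re; case: (c _).
  by rewrite distrC in im; apply: le_trans im; case: (c _).
apply: filterS unif => n unif.
rewrite sub0r normrN ger0_norm ?orlicz_norm_ge0//.
apply: le_trans kapd; have -> : 4 * kap = 2 * (kap + kap) by ring.
have mAh := measurable_complexB (mA (s n)) mh.
apply: orlicz_norm_le; first by rewrite mulr_gt0// addr_gt0.
rewrite /modular -(setvU (N k)) ge0_integral_setU//; last 4 first.
- exact: measurableC.
- exact/measurable_funTS/measurable_modular_integrand.
- by move=> x _; rewrite lee_fin (young_ge0 hPhi).
- by apply/disj_setPS => x [].
rewrite -DE.
have -> : (1 = (2^-1)%:E + (2^-1)%:E :> \bar R)%E.
  by rewrite -EFinD; congr EFin; field.
apply: leeD; first exact: tailD.
apply: (@le_trans _ _ (\int[mu]_(x in N k) (Phi a)%:E)%E).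
  apply: ae_ge0_le_integral => //.
  - by move=> x _; rewrite lee_fin (young_ge0 hPhi).
  - exact/measurable_funTS/measurable_modular_integrand.
  - by move=> x _; rewrite lee_fin (young_ge0 hPhi).
  apply: filterS3 good onF (covF k) => x [_ hL] hF hcov Nx.
  have [i lt Fx] := hcov Nx.
  rewrite lee_fin (young_le hPhi) ?divr_ge0 ?modulus_ge0//.
    by rewrite ltW// mulr_gt0// addr_gt0.
  rewrite ler_pdivrMr; last by rewrite mulr_gt0// addr_gt0.
  have -> : modulus (A (f (s n)) \- h) x =
      Normc.normc (c ((k, i), s n) - L (k, i)).
    by rewrite -(hL _ _ lt Fx) -(hF _ _ _ lt Fx).
  exact: unif.
rewrite integral_cst// qE -EFinM lee_fin Pa.
rewrite mulrC mulrA mulr1 ler_pdivrMr; last by rewrite mulr_gt0// ltr_wpDl.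
rewrite mulrA mulVf// mul1r; lra.
Qed.

End Sufficiency.

(** * Compactness of the weighted conditional expectation *)

Theorem theorem2p3 (R : realType) (d : measure_display) (T : measurableType d)
    (mu : {measure set T -> \bar R}) (G : set (set T))
    (hG : sigma_algebra [set: T] G)
    (hGsub : G `<=` (measurable : set (set T)))
    (hGfin : sigma_finite [set: g_sigma_algebraType G] mu)
    (Phi : R -> R) (hPhi : young_function Phi)
    (u : T -> R[i]) (hu : measurable_complex u)
    (hT : condexp_mul_bounded mu G Phi u) :
  let Psi := complementary Phi in
  let w := fun x => young_inv Psi (condexp_young mu G Psi u x) in
  [/\ orlicz_compact mu Phi (condexp_mul mu G u) ->
      forall eps : R, 0 < eps ->
        finitely_many_atoms mu G
          [set x | eps <= modulus (condexpC mu G u) x],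
      young_function Psi ->
      orlicz_compact mu Phi (condexp_mul mu G u) -> delta_prime Phi ->
      forall eps : R, 0 < eps ->
        finitely_many_atoms mu G [set x | (eps%:E <= w x)%E] &
      young_function Psi ->
      holder_conditional mu G Phi ->
      (forall eps : R, 0 < eps ->
        finitely_many_atoms mu G [set x | (eps%:E <= w x)%E]) ->
      orlicz_compact mu Phi (condexp_mul mu G u)].
Proof.
split.
- by move=> cpt eps eps0; apply: compact_finitely_many_atoms_condexp cpt.
- move=> hPsi cpt hD eps eps0.
  by apply: compact_finitely_many_atoms_dual cpt hD.
- move=> hPsi holder fin.
  by apply: compact_of_finitely_many_atoms holder fin.
Qed.
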